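(* Let $R$ be an associative ring (with identity) of characteristic zero such that any nonzero ideal of $R$ is of finite index. Let $n\geq 3$ and let $E<E_n(R)$ be a finite-index subgroup. Let $G$ be one of the following: a $\mathrm{CAT}(0)$ group or, more generally, a semi-hyperbolic group; a group acting properly semi-simply on a $\mathrm{CAT}(0)$ space; or a group acting properly semi-simply on a $\delta$-hyperbolic space. Then any group homomorphism $f:E\to G$ has finite image.
   Context: Rings are associative with identity, and ideal means two-sided ideal. $E_n(R)\le \mathrm{GL}_n(R)$ is the subgroup generated by the elementary matrices $e_{ij}(r)$ ($1\le i\ne j\le n$, $r\in R$), where $e_{ij}(r)$ has $1$'s on the diagonal, $r$ in position $(i,j)$ and zeros elsewhere. $\mathrm{CAT}(0)$ spaces are assumed complete; a group is $\mathrm{CAT}(0)$ if it acts properly discontinuously and cocompactly by isometries on a $\mathrm{CAT}(0)$ space. An isometry $g$ of a $\mathrm{CAT}(0)$ space $X$ is semisimple if the infimum $\inf_{x\in X}d(x,gx)$ is attained. A geodesic metric space is (Gromov) $\delta$-hyperbolic ($\delta>0$) if each side of any geodesic triangle is contained in the $\delta$-neighbourhood of the other two sides. An isometry $\gamma$ of a $\delta$-hyperbolic space $X$ is elliptic if its orbits $\{\gamma^n x\}_{n\in\mathbb{Z}}$ are bounded, hyperbolic if $n\mapsto\gamma^n x_0$ is a quasi-isometric embedding $\mathbb{Z}\to X$, and semisimple if it is elliptic or hyperbolic. An action is semi-simple if it is isometric and each group element acts as a semisimple isometry. An isometric action on a $\mathrm{CAT}(0)$ space is proper if every point has a ball $B$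 such that $\{g: gB\cap B\ne\emptyset\}$ is finite; on a $\delta$-hyperbolic space it is proper if $\{g: d(x,gx)\le r\}$ is finite for every point $x$ and $r>0$. A finitely generated group $\Gamma$ with word metric $d$ is semi-hyperbolic if there is a choice, for each $(x,y)\in\Gamma\times\Gamma$, of an eventually constant path $s_{(x,y)}:\mathbb{N}\to\Gamma$ from $x$ to $y$, constant from time $T_{(x,y)}$ on, and constants $\lambda\ge1$, $\varepsilon\ge0$, $k_1,k_2\geq 0$ such that each restriction $s_{(x,y)}|_{[0,T_{(x,y)}]}$ is a $(\lambda,\varepsilon)$-quasi-geodesic, $d(s_{(x,y)}(t),s_{(x',y')}(t))\le k_1\max\{d(x,x'),d(y,y')\}+k_2$ for all $t$, and $\gamma\cdot s_{(x,y)}(t)=s_{(\gamma x,\gamma y)}(t)$ for all $\gamma\in\Gamma$. *)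

(* Defs.v *)
From HB Require Import structures.
From mathcomp Require Import all_boot all_order all_algebra.
From mathcomp Require Import all_classical all_reals all_analysis.

Set Implicit Arguments.
Unset Strict Implicit.
Unset Printing Implicit Defensive.

Import Order.TTheory GRing.Theory Num.Theory.

Local Open Scope classical_set_scope.
Local Open Scope ring_scope.

(** * Rings *)

(* The library's [[pchar R] =i pred0] only excludes prime characteristic
   (it holds for Z/4Z), hence this definition. *)
Definition char_zero (R : nzRingType) : Prop :=
  forall m : nat, (0 < m)%N -> m%:R != 0 :> R.

Definition two_sided_ideal (R : nzRingType) (I : set R) : Prop :=
  zmod_closed (mem I) /\
  forall a x : R, I x -> I (a * x) /\ I (x * a).

Definition ideal_finite_index (R : nzRingType) (I : set R) : Prop :=
  finite_set (range (fun x : R => [set x + y | y in I])).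

(** * The general linear group of a (possibly noncommutative) ring *)

(* [unitmx] requires a commutative ring.  An element is a matrix paired with
   its (unique) two-sided inverse. *)
Definition mutually_inverse_mx (R : nzRingType) (n : nat) :
    pred ('M[R]_n * 'M[R]_n) :=
  fun p => (p.1 *m p.2 == 1%:M) && (p.2 *m p.1 == 1%:M).

Record GLn (R : nzRingType) (n : nat) := MkGLn {
  GLn_pair : 'M[R]_n * 'M[R]_n;
  _ : mutually_inverse_mx GLn_pair }.

HB.instance Definition _ (R : nzRingType) (n : nat) :=
  [isSub for @GLn_pair R n].
HB.instance Definition _ (R : nzRingType) (n : nat) :=
  [Choice of GLn R n by <:].

Section GLnGroup.
Variables (R : nzRingType) (n : nat).
Implicit Types g h : GLn R n.

Definition GLn_mx g : 'M[R]_n := (val g).1.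
Definition GLn_inv_mx g : 'M[R]_n := (val g).2.

Lemma GLn_mxK g : GLn_mx g *m GLn_inv_mx g = 1%:M.
Proof. by case: g => p Hp; case/andP: (Hp) => /eqP. Qed.

Lemma GLn_mxVK g : GLn_inv_mx g *m GLn_mx g = 1%:M.
Proof. by case: g => p Hp; case/andP: (Hp) => _ /eqP. Qed.

Lemma GLn_mx_inj : injective GLn_mx.
Proof.
move=> g h gh; apply/val_inj; rewrite [val g]surjective_pairing.
rewrite [val h]surjective_pairing; congr (_, _); first exact: gh.
rewrite -[(val g).2]mulmx1 -(GLn_mxK h) mulmxA -gh.
by rewrite (GLn_mxVK g) mul1mx.
Qed.

Fact GLn_one_subproof : @mutually_inverse_mx R n (1%:M, 1%:M).
Proof. by rewrite /mutually_inverse_mx /= mulmx1 eqxx. Qed.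

Fact GLn_mul_subproof g h :
  mutually_inverse_mx
    (GLn_mx g *m GLn_mx h, GLn_inv_mx h *m GLn_inv_mx g).
Proof.
apply/andP; split=> /=; apply/eqP.
  by rewrite mulmxA -(mulmxA (GLn_mx g)) GLn_mxK mulmx1 GLn_mxK.
by rewrite mulmxA -(mulmxA (GLn_inv_mx h)) GLn_mxVK mulmx1 GLn_mxVK.
Qed.

Fact GLn_inv_subproof g : mutually_inverse_mx (GLn_inv_mx g, GLn_mx g).
Proof. by apply/andP; rewrite /= GLn_mxK GLn_mxVK. Qed.

Definition GLn_one : GLn R n := MkGLn GLn_one_subproof.
Definition GLn_mul g h : GLn R n := MkGLn (GLn_mul_subproof g h).
Definition GLn_inv g : GLn R n := MkGLn (GLn_inv_subproof g).

Fact GLn_mulA : associative GLn_mul.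
Proof. by move=> g h k; apply: GLn_mx_inj; rewrite /GLn_mx /= mulmxA. Qed.
Fact GLn_mul1 : left_id GLn_one GLn_mul.
Proof. by move=> g; apply: GLn_mx_inj; rewrite /GLn_mx /= mul1mx. Qed.
Fact GLn_mulr1 : right_id GLn_one GLn_mul.
Proof. by move=> g; apply: GLn_mx_inj; rewrite /GLn_mx /= mulmx1. Qed.
Fact GLn_mulV : left_inverse GLn_one GLn_inv GLn_mul.
Proof. by move=> g; apply: GLn_mx_inj; exact: GLn_mxVK. Qed.
Fact GLn_mulrV : right_inverse GLn_one GLn_inv GLn_mul.
Proof. by move=> g; apply: GLn_mx_inj; exact: GLn_mxK. Qed.

HB.instance Definition _ := isGroup.Build (GLn R n)
  GLn_mulA GLn_mul1 GLn_mulr1 GLn_mulV GLn_mulrV.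

End GLnGroup.

(** * Subgroups *)

Definition is_subgroup (G : groupType) (H : set G) : Prop :=
  group_closed (mem H).

Definition finite_index (G : groupType) (H E : set G) : Prop :=
  finite_set [set [set (x * h)%g | h in E] | x in H].

Definition elementary_mx (R : nzRingType) (n : nat) (i j : 'I_n) (r : R) :
    'M[R]_n :=
  1%:M + r *: delta_mx i j.

Definition elementary_group (R : nzRingType) (n : nat) : set (GLn R n) :=
  smallest (@is_subgroup (GLn R n))
    [set g | exists i j r, i != j /\ GLn_mx g = elementary_mx i j r].
Arguments elementary_group : clear implicits.

(** * Geodesic metric spaces *)

Section MetricSpaces.
Variables (K : realType) (X : metricType K).

Definition geodesic (x y : X) (c : K -> X) : Prop :=
  [/\ c 0 = x, c (mdist x y) = y &
      {in `[0, mdist x y] &, forall s t : K, mdist (c s) (c t) = `|s - t|}].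

Definition geodesic_segment (x y : X) (S : set X) : Prop :=
  exists2 c, geodesic x y c & S = c @` `[0, mdist x y].

(* Spaces are nonempty: every group acts on the empty space, vacuously
   properly and cocompactly. *)
Definition geodesic_space : Prop :=
  [set: X] !=set0 /\ forall x y : X, exists c, geodesic x y c.

(* The side [S i] joins the vertices [v i] and [v (i + 1 mod 3)]. *)
Definition geodesic_triangle (v : 'I_3 -> X) (S : 'I_3 -> set X) : Prop :=
  forall i, geodesic_segment (v i) (v (ordS i)) (S i).

Definition eucl_dist (u w : 'rV[K]_2) : K :=
  Num.sqrt (\sum_(k < 2) (u 0 k - w 0 k) ^+ 2).

Definition eucl_segment (u w : 'rV[K]_2) : set 'rV[K]_2 :=
  [set (1 - t) *: u + t *: w | t in `[0, 1]].

Definition comparison_triangle (v : 'I_3 -> X) (w : 'I_3 -> 'rV[K]_2) : Prop :=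
  forall i j, eucl_dist (w i) (w j) = mdist (v i) (v j).

(* [p'] is the comparison point of the point [p] of the side [S i]. *)
Definition comparison_point (v : 'I_3 -> X) (w : 'I_3 -> 'rV[K]_2) (i : 'I_3)
    (p : X) (p' : 'rV[K]_2) : Prop :=
  eucl_segment (w i) (w (ordS i)) p' /\ eucl_dist (w i) p' = mdist (v i) p.

Definition cat0_inequality : Prop :=
  forall v S w, geodesic_triangle v S -> comparison_triangle v w ->
  forall (i j : 'I_3) (p q : X) (p' q' : 'rV[K]_2),
    S i p -> S j q ->
    comparison_point v w i p p' -> comparison_point v w j q q' ->
    mdist p q <= eucl_dist p' q'.

(* The library's [completeType] requires a distinguished point. *)
Definition complete_space : Prop :=
  forall F : set_system X, ProperFilter F -> cauchy F ->
    exists x : X, F --> x.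

Definition cat0_space : Prop :=
  [/\ geodesic_space, complete_space & cat0_inequality].

Definition hyperbolic_space (delta : K) : Prop :=
  geodesic_space /\
  forall v S, geodesic_triangle v S ->
    forall (i : 'I_3) (p : X), S i p ->
    exists j q, [/\ j != i, S j q & mdist p q < delta].

End MetricSpaces.

(** * Isometric actions *)

Definition quasi_isometric_on (K : realType) (A B : Type) (D : set A)
    (dA : A -> A -> K) (dB : B -> B -> K) (lam eps : K) (f : A -> B) : Prop :=
  forall a b, D a -> D b ->
    lam^-1 * dA a b - eps <= dB (f a) (f b) <= lam * dA a b + eps.

Definition expgz (G : groupType) (g : G) (m : int) : G :=
  match m with
  | Posz k => (g ^+ k)%g
  | Negz k => (g ^- k.+1)%g
  end.

Section Actions.
Variables (K : realType) (G : groupType) (X : metricType K).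
Variable act : G -> X -> X.

Definition isometric_action : Prop :=
  [/\ forall x, act 1%g x = x,
      forall g h x, act (g * h)%g x = act g (act h x) &
      forall g x y, mdist (act g x) (act g y) = mdist x y].

Definition cocompact_action : Prop :=
  exists2 C : set X, compact C & \bigcup_g (act g @` C) = [set: X].

Definition cat0_proper : Prop :=
  forall x : X, exists2 r : K, 0 < r &
    finite_set [set g | (act g @` ball x r) `&` ball x r !=set0].

Definition cat0_semisimple (g : G) : Prop :=
  exists x : X, mdist x (act g x) = inf (range (fun y => mdist y (act g y))).

Definition hyp_proper : Prop :=
  forall (x : X) (r : K), 0 < r -> finite_set [set g | mdist x (act g x) <= r].

Definition elliptic (g : G) : Prop :=
  forall x : X, exists M : K, forall m m' : int,
    mdist (act (expgz g m) x) (act (expgz g m') x) <= M.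

Definition hyperbolic (g : G) : Prop :=
  exists (x0 : X) (lam eps : K), [/\ 1 <= lam, 0 <= eps &
    quasi_isometric_on [set: int] (fun m m' => `|m - m'|%:~R) mdist lam eps
      (fun m => act (expgz g m) x0)].

Definition hyp_semisimple (g : G) : Prop := elliptic g \/ hyperbolic g.

End Actions.

(** * Classes of groups *)

Definition cat0_group (K : realType) (G : groupType) : Prop :=
  exists (X : metricType K) (act : G -> X -> X),
    [/\ cat0_space X, isometric_action act, cat0_proper act
      & cocompact_action act].

Definition acts_properly_semisimply_on_cat0 (K : realType) (G : groupType) :
    Prop :=
  exists (X : metricType K) (act : G -> X -> X),
    [/\ cat0_space X, isometric_action act, cat0_proper act
      & forall g, cat0_semisimple act g].

Definition acts_properly_semisimply_on_hyperbolic (K : realType)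
    (G : groupType) : Prop :=
  exists (X : metricType K) (delta : K) (act : G -> X -> X),
    [/\ 0 < delta, hyperbolic_space X delta, isometric_action act,
        hyp_proper act & forall g, hyp_semisimple act g].

Definition word_over (G : groupType) (S : set G) (w : seq G) : Prop :=
  forall a, a \in w -> S a \/ S (a^-1)%g.

(* [d x y] is the least length of a word over [S] and its inverses representing
   [x^-1 * y]; the existence of such a [d] entails that [S] generates [G]. *)
Definition is_word_metric (G : groupType) (S : set G) (d : G -> G -> nat) :
    Prop :=
  forall x y : G,
    (exists w : seq G,
      [/\ word_over S w, (\prod_(a <- w) a = x^-1 * y)%g & size w = d x y]) /\
    (forall w : seq G, word_over S w -> (\prod_(a <- w) a = x^-1 * y)%g ->
      (d x y <= size w)%N).

Definition semi_hyperbolic_group (K : realType) (G : groupType) : Prop :=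
  exists (S : set G) (d : G -> G -> nat)
         (s : G -> G -> nat -> G) (T : G -> G -> nat) (lam eps k1 k2 : K),
    [/\ finite_set S /\ is_word_metric S d,
        [/\ 1 <= lam, 0 <= eps, 0 <= k1 & 0 <= k2],
        forall x y, [/\ s x y 0%N = x,
          forall t, (T x y <= t)%N -> s x y t = y &
          quasi_isometric_on [set t | (t <= T x y)%N]
            (fun t t' : nat => `|t%:R - t'%:R|) (fun a b => (d a b)%:R) lam eps
            (s x y)],
        forall x y x' y' t,
          (d (s x y t) (s x' y' t))%:R
            <= k1 * (maxn (d x x') (d y y'))%:R + k2 &
        forall g x y t, (g * s x y t)%g = s (g * x)%g (g * y)%g t].

(* Main.v *)
Require Import Defs.
From HB Require Import structures.
From mathcomp Require Import all_boot all_order all_algebra.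
From mathcomp Require Import all_classical all_reals all_analysis.
From mathcomp Require Import zify ring lra.
From Stdlib Require Ncring Ncring_tac.

Set Implicit Arguments.
Unset Strict Implicit.
Unset Printing Implicit Defensive.

Import Order.TTheory GRing.Theory Num.Theory.

Local Open Scope classical_set_scope.
Local Open Scope ring_scope.

(** Write [e_ij(r)] for the elementary matrices and [K] for the kernel of [f].

    The relation [[e_ij(a), e_jk(b)] = e_ik(a b)] exhibits every [e_ik(r)] as a
    central commutator [z = [x, y]] in a Heisenberg group, where
    [z^(m^2) = [x^m, y^m]] has length [O(m)].  In each of the groups [G] such a
    distorted element has finite order.
    - On a hyperbolic space it is not a hyperbolic isometry, so its orbits are
      bounded and properness applies.
    - On a CAT(0) space, comparing midpoints gives
      [inf d(p, g^2 p) >= 2 inf d(p, g p)], so [z] has points of arbitrarily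
      small displacement; it then has a fixed point if it is semisimple, and a
      conjugate of [z] has one if the action is cocompact.
    - In a semi-hyperbolic group, centralizers of finite sets are finitely
      generated and undistorted.  Hence [z] lies in an undistorted finitely
      generated abelian subgroup, the center of its centralizer, where
      elements of infinite order are not distorted.

    Since [f (e_ik(r))] has finite order for some integer [r > 0], commutators give
    an integer [q > 0] such that [K] contains [e_ij(q r)] for [i <> j] and all [r];
    the same holds for the normal core [N] of [K] in [E_n(R)].  As [R] has
    characteristic zero, [I = q R] is a nonzero ideal, so [R / I] is finite.

    It remains to see that [E_n(R) / N] is finite.  It is a quotient of a
    Steinberg group over the finite ring [R / I], and the proof avoids K-theory.
    An element of [E_n(R)] that fixes a coordinate and is congruent to the
    identity modulo [I] is central modulo [N] ([fixes_central]), so there are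
    finitely many elements fixing a given coordinate, modulo the center.  A
    decomposition of Gauss type ([elementary_gauss]), which rests on the fact
    that finite rings have stable rank one ([stable_rank_one]), writes every
    element of [E_n(R)] modulo [N] as a product of boundedly many such elements
    and unipotent ones.  Hence the center of [E_n(R) / N] has finite index, the
    generators [e_ij(r)] have finitely many conjugates there, and they have
    finite order: by [Dietzmann] the quotient is finite. *)

(** * Groups modulo a subgroup *)

Ltac group_simp := rewrite ?commgEl ?conjgE
  ?(invgM, invgK, mulgA, mulgK, mulgVK, mulgV, mulVg, mulg1, mul1g, invg1).

Lemma bounded_words (T : eqType) (X : seq T) (m : nat) : exists s : seq (seq T),
  forall l, {subset l <= X} -> (size l <= m)%N -> l \in s.
Proof.
elim: m => [|m [s sP]]; first by exists [:: [::]] => -[].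
exists ([::] :: [seq x :: l | x <- X, l <- s]) => -[//|x l] xlX sl.
rewrite inE /=; apply: allpairs_f; first by apply: xlX; rewrite mem_head.
by apply: sP => // y yl; apply: xlX; rewrite inE yl orbT.
Qed.

Definition torsion (G : groupType) (g : G) :=
  exists2 k, (0 < k)%N & (g ^+ k = 1)%g.

Section Subgroups.
Variable G : groupType.
Implicit Types (x y g h : G) (H : set G).
Local Open Scope group_scope.

Lemma subgroup1 H : is_subgroup H -> H 1.
Proof. by case=> /set_mem. Qed.

Lemma subgroupF H x y : is_subgroup H -> H x -> H y -> H (x / y).
Proof. by case=> _ HF Hx Hy; apply/set_mem/HF; exact/mem_set. Qed.

Lemma subgroupV H x : is_subgroup H -> H x -> H x^-1.
Proof. by move=> sH Hx; rewrite -div1g; apply: subgroupF => //; exact: subgroup1. Qed.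

Lemma subgroupM H x y : is_subgroup H -> H x -> H y -> H (x * y).
Proof.
by move=> sH Hx Hy; rewrite -[y]invgK; apply: subgroupF => //; exact: subgroupV.
Qed.

Lemma subgroupX H x m : is_subgroup H -> H x -> H (x ^+ m).
Proof.
move=> sH Hx; elim: m => [|m IHm]; first exact: subgroup1.
by rewrite expgS; exact: subgroupM.
Qed.

Lemma subgroupJ H x y : is_subgroup H -> H x -> H y -> H (x ^ y).
Proof. by move=> sH Hx Hy; rewrite conjgE; do ?apply: subgroupM => //; exact: subgroupV. Qed.

Lemma subgroupR H x y : is_subgroup H -> H x -> H y -> H [~ x, y].
Proof.
by move=> sH Hx Hy; rewrite commgEl; apply: subgroupM => //;
  [exact: subgroupV|exact: subgroupJ].
Qed.

Lemma is_subgroupI H : H 1 -> (forall x y, H x -> H y -> H (x * y)) ->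
  (forall x, H x -> H x^-1) -> is_subgroup H.
Proof.
move=> H1 HM HV; split; first exact/mem_set.
by move=> x y /set_mem Hx /set_mem Hy; apply/mem_set/HM => //; exact: HV.
Qed.

Lemma smallest_subgroup (S : set G) : is_subgroup (smallest (@is_subgroup G) S).
Proof.
apply: is_subgroupI => [H [sH _]|x y Sx Sy H SH|x Sx H SH].
- exact: subgroup1.
- by apply: subgroupM; [case: SH|exact: Sx|exact: Sy].
- by apply: subgroupV; [case: SH|exact: Sx].
Qed.

(** A word of length [4 m] in [x] and [y] thus reaches the power [m ^ 2] of the
    commutator: this distortion is what the target groups do not tolerate. *)
Lemma commXX x y m : commute [~ x, y] x -> commute [~ x, y] y ->
  [~ x ^+ m, y ^+ m] = [~ x, y] ^+ (m * m).
Proof.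
move=> zx zy; set z := [~ x, y] in zx zy *.
have xy k : x ^ (y ^+ k) = x * z ^+ k.
  elim: k => [|k IHk]; first by rewrite !expg0 conjg1 mulg1.
  rewrite expgSr conjgM IHk conjMg conjXg.
  have -> : z ^ y = z by apply/conjg_fixP/commgP.
  have -> : x ^ y = x * z by rewrite /z; group_simp.
  by rewrite -mulgA -expgS.
rewrite commgEl conjXg xy expgMn; last exact/commuteX/commute_sym.
by rewrite mulKg expgnA.
Qed.

End Subgroups.

Section FiniteModulo.
Variable G : groupType.
Implicit Types (x y g h : G) (H Z S T : set G).
Local Open Scope group_scope.

(** The image of [S] in the set of left cosets of [Z] is finite, expressed
    without forming that set. *)
Definition finite_mod Z S := exists s : seq G,
  forall g, S g -> exists2 y, y \in s & Z (y^-1 * g).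

Lemma finite_mod_sub Z S T : S `<=` T -> finite_mod Z T -> finite_mod Z S.
Proof. by move=> ST [s sT]; exists s => g /ST; exact: sT. Qed.

Lemma finite_mod_invariant Z S (F : finType) (p : G -> F) :
  (forall g h, S g -> S h -> p g = p h -> Z (g^-1 * h)) -> finite_mod Z S.
Proof.
move=> pZ; pose c a := xget 1 [set g | S g /\ p g = a].
exists [seq c a | a <- enum F] => g Sg; exists (c (p g)).
  by apply: map_f; rewrite mem_enum.
by rewrite /c; case: xgetP => [h _ [Sh ph]|/(_ g)[]//]; exact: pZ.
Qed.

Lemma finite_mod_repeat Z S : is_subgroup Z -> finite_mod Z S ->
  exists m, forall u : nat -> G, (forall i, S (u i)) ->
  exists i j, (i < j <= m)%N /\ Z ((u i)^-1 * u j).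
Proof.
move=> sZ [s sS]; exists (size s) => u Su.
pose c i := index (xget 1 [set y | y \in s /\ Z (y^-1 * u i)]) s.
have cP i : (c i < size s)%N /\ Z ((nth 1 s (c i))^-1 * u i).
  rewrite /c; case: xgetP => [y _ [ys Zy]|no].
    by rewrite index_mem ys nth_index.
  by case: (sS _ (Su i)) => y ys Zy; case: (no y).
pose f (i : 'I_(size s).+1) := Ordinal (cP i).1.
have /injectivePn[i [j ij]] : ~~ injectiveb f.
  by apply/negP => /injectiveP /leq_card; rewrite !card_ord ltnn.
move=> /(congr1 val) /= cij.
wlog lt_ij : i j ij cij / (i < j)%N.
  move=> W; case: (ltngtP i j) => [|ji|/val_inj eij]; first exact: W.
    by apply: (W j i) => //; rewrite eq_sym.
  by rewrite eij eqxx in ij.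
exists i, j; split; first by rewrite lt_ij -ltnS ltn_ord.
have -> : (u i)^-1 * u j
    = ((nth 1 s (c i))^-1 * u i)^-1 * ((nth 1 s (c j))^-1 * u j).
  by rewrite cij; group_simp.
by apply: subgroupM => //; [apply: subgroupV => //; exact: (cP i).2|exact: (cP j).2].
Qed.

(** For [N] normal in [A], the relation [N (g^-1 * h)] is a congruence on [A];
    it stands for equality in [A / N]. *)
Variables (A N : set G).
Hypotheses (sA : is_subgroup A) (sN : is_subgroup N) (NA : N `<=` A).
Hypothesis N_normal : forall x g, N x -> A g -> N (x ^ g).

Lemma cong_mul g g' h h' : A h -> N (g^-1 * g') -> N (h^-1 * h') ->
  N ((g * h)^-1 * (g' * h')).
Proof.
move=> Ah Ng Nh; have -> : (g * h)^-1 * (g' * h')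
    = (g^-1 * g') ^ h * (h^-1 * h') by group_simp.
by apply: subgroupM => //; exact: N_normal.
Qed.

Lemma cong_trans g h k : N (g^-1 * h) -> N (h^-1 * k) -> N (g^-1 * k).
Proof.
move=> gh hk; have -> : g^-1 * k = (g^-1 * h) * (h^-1 * k) by group_simp.
exact: subgroupM.
Qed.

Lemma cong_sym g h : N (g^-1 * h) -> N (h^-1 * g).
Proof.
move=> gh; have -> : h^-1 * g = (g^-1 * h)^-1 by group_simp.
exact: subgroupV.
Qed.

Lemma cong_refl g : N (g^-1 * g).
Proof. by rewrite mulVg; exact: subgroup1. Qed.

Lemma cong_in g h : A h -> N (g^-1 * h) -> A g.
Proof.
move=> Ah /NA gh; have -> : g = h / (g^-1 * h) by group_simp.
exact: subgroupF.
Qed.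

Lemma finite_mod_mul S T : S `<=` A -> T `<=` A ->
  finite_mod N S -> finite_mod N T ->
  finite_mod N [set x * y | x in S & y in T].
Proof.
move=> SA TA [s sS] [t tT]; exists [seq x * y | x <- s, y <- t].
move=> _ [x Sx [y Ty <-]]; case: (sS _ Sx) => x' sx' Nx; case: (tT _ Ty) => y' ty' Ny.
exists (x' * y'); first exact: allpairs_f.
by apply: cong_mul => //; apply: cong_in Ny; exact: TA.
Qed.

(** A finite conjugation-invariant set [X] of torsion elements generates a
    finite group (Dietzmann): if a letter [w] occurs [q] times in a word, its
    occurrences can be collected on the left, at the cost of conjugating the
    other letters, which stay in [X]; then [w ^+ q = 1] disappears.  Hence every
    element has a word of length at most [q * size X]. *)
Section Dietzmann.
Variables (X : seq G) (q : nat).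
Hypotheses (XA : {in X, forall w, A w}) (q_gt0 : (0 < q)%N).
Hypothesis X_torsion : {in X, forall w, N (w ^+ q)}.
Hypothesis X_conj : forall w g, w \in X -> A g ->
  exists2 w', w' \in X & N (w'^-1 * w ^ g).

Let word (l : seq G) : G := \prod_(w <- l) w.

Let word_A l : {subset l <= X} -> A (word l).
Proof.
elim: l => [_|w l IHl wlX]; first by rewrite /word big_nil; exact: subgroup1.
rewrite /word big_cons; apply: subgroupM => //.
  by apply/XA/wlX; rewrite mem_head.
by apply: IHl => v vl; apply: wlX; rewrite inE vl orbT.
Qed.

Let collect w l k : {subset l <= X} -> w \in X -> (k <= count_mem w l)%N ->
  exists l', [/\ {subset l' <= X}, (size l' + k = size l)%N
               & N ((w ^+ k * word l')^-1 * word l)].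
Proof.
move=> + wX; elim: l k => [|v l IHl] k vlX.
  rewrite leqn0 => /eqP->; exists [::]; rewrite expg0 mul1g mulVg.
  by split=> //; exact: subgroup1.
have vX : v \in X by apply: vlX; rewrite mem_head.
have lX : {subset l <= X} by move=> u ul; apply: vlX; rewrite inE ul orbT.
have Aw m : A (w ^+ m) by apply: subgroupX => //; exact: XA.
rewrite /= => kl; have [ewv|nwv] := eqVneq v w.
  case: k kl => [|k] kl.
    by exists (v :: l); rewrite expg0 mul1g mulVg addn0; split=> //; exact: subgroup1.
  have [|l' [l'X sl' Nl']] := IHl k lX; first by move: kl; rewrite ewv eqxx add1n ltnS.
  exists l'; split=> //=; first by rewrite -sl' addnS.
  rewrite ewv expgS -mulgA /word big_cons; apply: cong_mul => //.
    by apply: subgroupM => //; exact: word_A.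
  exact: cong_refl.
have [|l' [l'X sl' Nl']] := IHl k lX; first by move: kl; rewrite (negbTE nwv) add0n.
have [v' v'X Nv'] := X_conj vX (Aw k).
exists (v' :: l'); split=> /=; last 1 first.
- rewrite /word !big_cons -/(word l') -/(word l).
  apply: (@cong_trans _ (v * (w ^+ k * word l'))); last first.
    apply: cong_mul => //; last exact: cong_refl.
    by apply: subgroupM => //; exact: word_A.
  have -> : v * (w ^+ k * word l') = w ^+ k * (v ^ (w ^+ k) * word l').
    by group_simp.
  apply: cong_mul; last apply: cong_mul => //; first 1 last.
  + exact: cong_refl.
  + exact: word_A.
  + exact: cong_refl.
  by apply: subgroupM; [|exact: XA|exact: word_A].
- by move=> u; rewrite inE => /predU1P[->|/l'X].
- by rewrite addSn sl'.
Qed.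

Let short_word g : (exists2 l, {subset l <= X} & N ((word l)^-1 * g)) ->
  exists l, [/\ {subset l <= X}, (size l <= size X * q)%N & N ((word l)^-1 * g)].
Proof.
case=> l; have [m] := ubnP (size l); elim: m l => // m IHm l lm lX Nl.
case: (leqP (size l) (size X * q)) => [sl|Xl]; first by exists l.
have [w wX ql] : exists2 w, w \in X & (q <= count_mem w l)%N.
  apply: contrapT => no; move: Xl; apply/negP; rewrite -leqNgt.
  have -> : size l = (\sum_(w <- undup X) count_mem w l)%N.
    elim: (l) lX => [|v l' IH] vX /=; first by rewrite big1.
    rewrite big_split /= -IH; last by move=> u ul; apply: vX; rewrite inE ul orbT.
    rewrite (bigD1_seq v) ?undup_uniq ?mem_undup //=; last by apply: vX; rewrite mem_head.
    by rewrite eqxx big1 // => u; rewrite eq_sym => /negbTE->.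
  apply: (@leq_trans (\sum_(w <- undup X) q)); last first.
    by rewrite big_const_seq iter_addn_0 count_predT mulnC leq_mul2r size_undup orbT.
  rewrite big_seq [leqRHS]big_seq; apply: leq_sum => w; rewrite mem_undup => wX.
  by rewrite leqNgt; apply/negP => ql; apply: no; exists w => //; exact: ltnW.
have [l' [l'X sl' Nl']] := collect lX wX ql.
apply: (IHm l') => //; first by move: lm sl' q_gt0; lia.
apply: cong_trans Nl; apply: cong_trans Nl'.
rewrite -[X in N (X^-1 * _)]mul1g; apply: cong_mul; last exact: cong_refl.
  exact: word_A.
by rewrite invg1 mul1g; exact: X_torsion.
Qed.

Lemma Dietzmann (S : set G) : A = smallest (@is_subgroup G) S ->
  (forall g, S g -> exists2 w, w \in X & N (w^-1 * g)) -> finite_mod N A.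
Proof.
move=> defA SX.
have AX g : A g -> exists2 l, {subset l <= X} & N ((word l)^-1 * g).
  have sB : is_subgroup [set g | A g /\
      exists2 l, {subset l <= X} & N ((word l)^-1 * g)].
    apply: is_subgroupI => [|x y|x] /=.
    - split; first exact: subgroup1.
      by exists [::] => //; rewrite /word big_nil; exact: cong_refl.
    - case=> Ax [l lX Nl] [Ay [k kX Nk]]; split; first exact: subgroupM.
      exists (l ++ k); first by move=> v; rewrite mem_cat => /orP[/lX|/kX].
      by rewrite /word big_cat; apply: cong_mul => //; exact: word_A.
    case=> Ax [l lX Nl]; split; first exact: subgroupV.
    have [k kX Nk] : exists2 k, {subset k <= X} & N ((word k)^-1 * (word l)^-1).
      elim: l lX {Nl} => [_|v l IHl vlX].
        by exists [::] => //; rewrite /word big_nil !invg1 mulg1; exact: subgroup1.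
      have vX : v \in X by apply: vlX; rewrite mem_head.
      have [|k kX Nk] := IHl; first by move=> u ul; apply: vlX; rewrite inE ul orbT.
      exists (k ++ nseq q.-1 v).
        by move=> u; rewrite mem_cat mem_nseq => /orP[/kX//|/andP[_ /eqP->]].
      rewrite /word big_cat big_cons (invgM v); apply: cong_mul => //.
        have -> : \prod_(w <- nseq q.-1 v) w = v ^+ q.-1.
          by rewrite big_nseq iter_mulg_1.
        by apply: subgroupX => //; exact: XA.
      rewrite big_nseq iter_mulg_1.
      have -> : (v ^+ q.-1)^-1 / v = (v ^+ q)^-1.
        by rewrite -invgM -expgS prednK.
      by apply: subgroupV => //; exact: X_torsion.
    exists k => //; apply: cong_trans Nk _.
    have -> : (word l)^-1^-1 * x^-1 = ((word l)^-1 * x)^-1 ^ (word l)^-1.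
      by group_simp.
    by apply: N_normal; [exact: subgroupV|apply: subgroupV => //; exact: word_A].
  suff AB : A `<=` [set g | A g /\
      exists2 l, {subset l <= X} & N ((word l)^-1 * g)] by move=> /AB[].
  rewrite {1}defA; apply: smallest_sub => // x Sx; split.
    by rewrite defA; exact: sub_gen_smallest.
  have [w wX Nw] := SX _ Sx; exists [:: w]; last by rewrite /word big_seq1.
  by move=> v; rewrite inE => /eqP->.
have [s sP] := bounded_words X (size X * q).
exists [seq word l | l <- s] => g /AX /short_word[l [lX sl Nl]].
by exists (word l) => //; exact/map_f/sP.
Qed.

End Dietzmann.
End FiniteModulo.

(** * Stable rank one of finite rings *)

Lemma finite_image_invariant (T : Type) (U : choiceType) (f : T -> U)
    (S : set T) : finite_set (f @` S) ->
  exists (F : finType) (p : U -> F),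
    forall x y, S x -> S y -> p (f x) = p (f y) -> f x = f y.
Proof.
move=> /finite_seqP[X fX].
have inX x : S x -> f x \in X by move=> Sx; have : (f @` S) (f x) by []; rewrite fX.
exists 'I_(size X).+1, (fun u => inord (index u X)) => x y /inX fx /inX fy.
have ltX u : u \in X -> (index u X < (size X).+1)%N by rewrite -index_mem => /ltnW.
move=> /(congr1 val); rewrite /= !inordK ?ltX // => exy.
by rewrite -(nth_index (f x) fx) exy nth_index.
Qed.


#[export] Instance nzRing_ops (R : nzRingType) : Ncring.Ring_ops (T := R)
  (ring0 := 0) (ring1 := 1) (add := +%R) (mul := *%R)
  (sub := fun x y => x - y) (opp := -%R) (ring_eq := eq) := {}.
#[export] Instance nzRing_ring (R : nzRingType) : Ncring.Ring (Ro := nzRing_ops R).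
Proof.
split; try by move=> x _ <- y _ <-.
- exact: RelationClasses.eq_equivalence.
- by move=> x _ <-.
- exact: add0r.
- exact: addrC.
- exact: addrA.
- exact: mul1r.
- exact: mulr1.
- exact: mulrA.
- exact: mulrDl.
- by move=> x y z; exact: mulrDr.
- by [].
- exact: addrN.
Qed.

Ltac nc_ring := intros; Ncring_tac.non_commutative_ring.

Section Ideals.
Variables (R : nzRingType) (I : set R).
Hypothesis idI : two_sided_ideal I.
Implicit Types x y : R.

Lemma ideal_zero : I 0.
Proof. by case: idI => -[/set_mem]. Qed.

Lemma ideal_mull x y : I y -> I (x * y).
Proof. by case: idI => _ /(_ x y) H /H[]. Qed.

Lemma ideal_mulr x y : I x -> I (x * y).
Proof. by case: idI => _ /(_ y x) H /H[]. Qed.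

Lemma ideal_sub x y : I x -> I y -> I (x - y).
Proof. by case: idI => -[_ IB] _ Ix Iy; apply/set_mem/IB; exact/mem_set. Qed.

Lemma ideal_opp x : I x -> I (- x).
Proof. by move=> Ix; rewrite -sub0r; apply: ideal_sub => //; exact: ideal_zero. Qed.

Lemma ideal_add x y : I x -> I y -> I (x + y).
Proof. by move=> Ix Iy; rewrite -[y]opprK; apply: ideal_sub => //; exact: ideal_opp. Qed.

Lemma ideal_sum (T : Type) (r : seq T) (P : pred T) (f : T -> R) :
  (forall i, P i -> I (f i)) -> I (\sum_(i <- r | P i) f i).
Proof. by move=> If; elim/big_ind: _ => //; [exact: ideal_zero|exact: ideal_add]. Qed.

End Ideals.

Section FiniteIndexIdeal.
Variables (R : nzRingType) (I : set R).
Hypotheses (idI : two_sided_ideal I) (finI : ideal_finite_index I).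
Implicit Types x y z a b c d e g r s t : R.

Lemma ideal_class : exists (F : finType) (p : R -> F),
  forall x y, p x = p y <-> I (x - y).
Proof.
have [F [p pP]] := finite_image_invariant finI.
exists F, (fun x => p [set x + y | y in I]) => x y; split.
  move=> /pP e; have : [set x + y | y in I] x.
    by exists 0; [exact: ideal_zero|rewrite addr0].
  by rewrite e // => -[z Iz <-]; rewrite addrAC subrr add0r.
move=> Ixy; congr p; apply/seteqP; split=> _ [z Iz <-].
  by exists (x - y + z); [exact: ideal_add|nc_ring].
exists (z - (x - y)); first exact: ideal_sub.
by nc_ring.
Qed.

(* The powers of [x] are eventually periodic; an exponent that is a multiple of
   the period and past the preperiod does. *)
Let idempotent_power x : exists2 m, (0 < m)%N & I (x ^+ m * x ^+ m - x ^+ m).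
Proof.
have [F [p pP]] := ideal_class.
have [u [v [lt_uv Iuv]]] : exists u v : nat, (u < v)%N /\ I (x ^+ v - x ^+ u).
  have /injectivePn[i [j ij /pP Iij]] :
      ~~ injectiveb (fun i : 'I_#|F|.+1 => p (x ^+ i)).
    by apply/negP => /injectiveP /leq_card; rewrite card_ord ltnn.
  case: (ltngtP i j) => [lt_ij|lt_ji|/val_inj eij].
  - by exists i, j; split=> //; rewrite -opprB; exact: ideal_opp.
  - by exists j, i.
  - by rewrite eij eqxx in ij.
have exv : x ^+ v = x ^+ u * x ^+ (v - u) by rewrite -exprD subnKC // ltnW.
have period k : I (x ^+ (u + k * (v - u)) - x ^+ u).
  elim: k => [|k IHk]; first by rewrite mul0n addn0 subrr; exact: ideal_zero.
  have -> : (u + k.+1 * (v - u) = u + k * (v - u) + (v - u))%N by lia.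
  rewrite exprD; have -> : x ^+ (u + k * (v - u)) * x ^+ (v - u) - x ^+ u
    = (x ^+ (u + k * (v - u)) - x ^+ u) * x ^+ (v - u) + (x ^+ v - x ^+ u).
    by rewrite exv; nc_ring.
  by apply: ideal_add => //; exact: ideal_mulr.
exists (u.+1 * (v - u))%N; first by rewrite muln_gt0 subn_gt0.
have am : (u <= u.+1 * (v - u))%N by nia.
rewrite -exprD; set m := (_ * _)%N in am *.
have -> : x ^+ (m + m) - x ^+ m = (x ^+ (u + m) - x ^+ u) * x ^+ (m - u).
  by rewrite mulrBl -!exprD; congr (x ^+ _ - x ^+ _); lia.
by apply: ideal_mulr => //; exact: period.
Qed.

(** The inverse image in [R] of the Jacobson radical of the finite ring [R / I]. *)
Let J : set R := [set x | forall r, exists s, I ((1 - x * r) * s - 1)].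

Let J_ideal : two_sided_ideal J.
Proof.
have JMr x a : J x -> J (x * a).
  by move=> Jx r; have [s] := Jx (a * r); rewrite mulrA => Is; exists s.
have JMl a x : J x -> J (a * x).
  move=> Jx r; have [t It] := Jx (r * a); exists (1 + a * t * x * r).
  have -> : (1 - a * x * r) * (1 + a * t * x * r) - 1
     = a * ((1 - x * (r * a)) * t - 1) * (x * r) by nc_ring.
  by apply: ideal_mulr => //; exact: ideal_mull.
split=> [|a x Jx]; last by split; [exact: JMl|exact: JMr].
split; first by apply/mem_set => r; exists 1; rewrite mul0r subr0 mulr1 subrr; exact: ideal_zero.
move=> x y /set_mem Jx /set_mem Jy; apply/mem_set => r.
have [s Is] := Jx r; have [s' Is'] := JMr y (-1) Jy (r * s).
exists (s * s').
have -> : (1 - (x - y) * r) * (s * s') - 1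
   = ((1 - x * r) * s - 1) * s' + ((1 - y * -1 * (r * s)) * s' - 1) by nc_ring.
by apply: ideal_add => //; exact: ideal_mulr.
Qed.

Let subJ x : I x -> J x.
Proof.
move=> Ix r; exists 1; have -> : (1 - x * r) * 1 - 1 = - (x * r) by nc_ring.
by apply: ideal_opp => //; exact: ideal_mulr.
Qed.

(** If [1 - z] is not right invertible modulo [I] then no power of [z] vanishes
    there; as [R / I] is finite, some power of [z] is idempotent, and an
    idempotent [e] of the radical is zero because [1 - e] would be right
    invertible while [e (1 - e) = 0]. *)
Let idempotent_outside_radical (M : set R) :
  (forall x r, M x -> M (x * r)) -> (exists2 x, M x & ~ J x) ->
  exists g, [/\ M g, I (g * g - g) & ~ J g].
Proof.
move=> MM [x Mx /existsNP[r Jr]]; set z := x * r in Jr.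
have [[//|m] _ Im] := idempotent_power z; exists (z ^+ m.+1); split=> //.
  by rewrite exprS /z -mulrA; exact: MM.
move=> /(_ 1)[s Is]; apply: Jr; exists (\sum_(i < m.+1) z ^+ i).
have -> : (1 - z) * (\sum_(i < m.+1) z ^+ i) - 1 = - z ^+ m.+1.
  have := subrX1 z m.+1; move: (z ^+ m.+1) (\sum_(i < _) _) => Z u eZ.
  have -> : (1 - z) * u - 1 = - ((z - 1) * u) - 1 by nc_ring.
  by rewrite -eZ; nc_ring.
move: (z ^+ m.+1) Im Is => e Ie Is; apply: ideal_opp => //.
have -> : e = - (e * ((1 - e * 1) * s - 1)) - (e * e - e) * s by nc_ring.
by apply: ideal_sub => //; [apply: ideal_opp => //; exact: ideal_mull|exact: ideal_mulr].
Qed.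

(** Among the elements [c] of [a + bR] choose one for which [cR] is largest
    modulo the radical.  If [cR] is not everything there, then [c] kills an
    idempotent [g] outside the radical, and [c + b s g] has a larger image for
    some [s]: it agrees with [c] on [(1 - g) R] and maps [g] to [b s g].  Were
    [b s g] in [cR] for all [s], then [Rg] would be contained in [cRg], hence
    in [c^m Rg] for all [m], and an idempotent power of [c] would fix [g] while
    killing it. *)
Theorem stable_rank_one a b x y : I (a * x + b * y - 1) ->
  exists t c, I ((a + b * t) * c - 1).
Proof.
move=> Iab; have [F [p pP]] := ideal_class.
pose S c := [set z | exists r, J (z - c * r)].
pose size_mod c := #|[set k : F | `[< exists2 z, S c z & p z = k >]]%SET|.
pose P m := `[< exists t, size_mod (a + b * t) = m >].
have exP : exists m, P m by exists (size_mod (a + b * 0)); apply/asboolP; exists 0.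
have leP m : P m -> (m <= #|F|)%N by move=> /asboolP[t <-]; exact: max_card.
case: (ex_maxnP exP leP) => _ /asboolP[t <-] maxt {exP leP}.
set c := a + b * t in maxt.
suff [r Jr] : S c 1.
  have [s Is] := Jr 1; have {}Is : I (c * (r * s) - 1).
    by have -> : c * (r * s) = (1 - (1 - c * r) * 1) * s by nc_ring.
  by exists t, (r * s).
apply: contrapT => Sc1.
have [g [Jcg Igg Jg]] : exists g, [/\ J (c * g), I (g * g - g) & ~ J g].
  apply: (@idempotent_outside_radical [set z | J (c * z)]).
    by move=> z r /=; rewrite mulrA; exact: (ideal_mulr J_ideal).
  apply: contrapT => no; apply: Sc1.
  have [[//|m] _ Im] := idempotent_power c.
  have cancel_c k z : J (c ^+ k * z) -> J z.
    elim: k z => [|k IHk] z; first by rewrite expr0 mul1r.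
    rewrite exprSr -mulrA => /IHk Jcz; apply: contrapT => Jz; apply: no.
    by exists z.
  exists (c ^+ m); rewrite -exprS -opprB; apply: (ideal_opp J_ideal) => //.
  by apply: (cancel_c m.+1); rewrite mulrBr mulr1; exact: subJ.
have Jgg : J (g * g - g) by exact: subJ.
have [s Ss] : exists s, ~ S c (b * s * g).
  apply: contrapT => /forallNP Sb.
  have Srg r : exists r', J (r * g - c * r' * g).
    have [r1 J1] : S c (b * (y * r - t * x * r) * g) by exact: contrapT (Sb _).
    exists (x * r * g + r1).
    have -> : r * g - c * (x * r * g + r1) * g =
        (b * (y * r - t * x * r) * g - c * r1) * g
        - (a * x + b * y - 1) * (r * g) - (b * (y * r - t * x * r)) * (g * g - g)
        - c * x * r * (g * g - g) by rewrite /c; nc_ring.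
    do ?apply: (ideal_sub J_ideal) => //; try exact: (ideal_mull J_ideal).
      exact: (ideal_mulr J_ideal).
    exact/(ideal_mulr J_ideal)/subJ.
  have Sg k : exists r, J (g - c ^+ k * r * g).
    elim: k => [|k [r Jr]].
      by exists 1; rewrite expr0 !mul1r subrr; exact: (ideal_zero J_ideal).
    have [r' Jr'] := Srg r; exists r'.
    have -> : g - c ^+ k.+1 * r' * g
       = (g - c ^+ k * r * g) + c ^+ k * (r * g - c * r' * g).
      by rewrite exprSr; nc_ring.
    by apply: (ideal_add J_ideal) => //; exact: (ideal_mull J_ideal).
  have [[//|m] _ Im] := idempotent_power c; apply: Jg.
  have Jcm : J (c ^+ m.+1 * g) by rewrite exprSr -mulrA; exact: (ideal_mull J_ideal).
  have [r] := Sg m.+1; move: (c ^+ m.+1) Im Jcm => C IC JC Jr.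
  have -> : g = (g - C * r * g) - C * (g - C * r * g) - (C * C - C) * (r * g) + C * g.
    by nc_ring.
  apply: (ideal_add J_ideal) => //; apply: (ideal_sub J_ideal) => //; last first.
    exact/(ideal_mulr J_ideal)/subJ.
  by apply: (ideal_sub J_ideal) => //; exact: (ideal_mull J_ideal).
have := maxt (size_mod (a + b * (t + s * g))).
have -> : P (size_mod (a + b * (t + s * g))) by apply/asboolP; exists (t + s * g).
move=> /(_ isT); apply/negP; rewrite -ltnNge; apply: proper_card.
set c' := a + b * (t + s * g).
have Sc' z : S c z -> S c' z.
  case=> r Jr; exists ((1 - g) * r).
  have -> : z - c' * ((1 - g) * r) =
     (z - c * r) + (c * g + b * s * (g * g - g)) * r by rewrite /c' /c; nc_ring.
  apply: (ideal_add J_ideal) => //; apply: (ideal_mulr J_ideal) => //.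
  by apply: (ideal_add J_ideal) => //; exact: (ideal_mull J_ideal).
apply/properP; split.
  by apply/fintype.subsetP => k; rewrite !inE => -[z /Sc' Sz pz]; exists z.
exists (p (b * s * g)).
  rewrite !inE; exists (b * s * g) => //; exists g.
  have -> : b * s * g - c' * g = - (b * s * (g * g - g)) - c * g by rewrite /c' /c; nc_ring.
  by apply: (ideal_sub J_ideal) => //; apply: (ideal_opp J_ideal) => //; exact: (ideal_mull J_ideal).
apply/negP; rewrite !inE => -[z [r Jr] /pP Iz]; apply: Ss; exists r.
have -> : b * s * g - c * r = (z - c * r) - (z - b * s * g) by nc_ring.
by apply: (ideal_sub J_ideal) => //; exact: subJ.
Qed.

End FiniteIndexIdeal.

(** * Transvections *)

Section Transvections.
Variables (R : nzRingType) (n : nat).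
Implicit Types (u c : 'cV[R]_n) (v w : 'rV[R]_n) (g h : GLn R n) (a b r s : R).
Implicit Types i j k : 'I_n.

Definition colv i r : 'cV[R]_n := r *: delta_mx i 0.
Definition rowv j r : 'rV[R]_n := r *: delta_mx 0 j.

Lemma colvE i r k : colv i r k 0 = if k == i then r else 0.
Proof. by rewrite !mxE eqxx andbT; case: eqP; rewrite ?mulr1 ?mulr0. Qed.

Lemma rowvE j r k : rowv j r 0 k = if k == j then r else 0.
Proof. by rewrite !mxE eqxx /=; case: eqP; rewrite ?mulr1 ?mulr0. Qed.

Lemma mulmx_colv m (A : 'M[R]_(m, n)) i r x : (A *m colv i r) x 0 = A x i * r.
Proof.
rewrite mxE (bigD1 i) //= colvE eqxx big1 ?addr0 // => k /negbTE ki.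
by rewrite colvE ki mulr0.
Qed.

Lemma mulmx_rowv m (A : 'M[R]_(n, m)) j r x : (rowv j r *m A) 0 x = r * A j x.
Proof.
rewrite mxE (bigD1 j) //= rowvE eqxx big1 ?addr0 // => k /negbTE kj.
by rewrite rowvE kj mul0r.
Qed.

Lemma mulmx_col_row m p (u : 'cV[R]_m) (v : 'rV[R]_p) (i : 'I_m) (j : 'I_p) :
  (u *m v) i j = u i 0 * v 0 j.
Proof. by rewrite mxE big_ord1. Qed.

Lemma rowv_mul_col0 j r u : u j 0 = 0 -> rowv j r *m u = 0.
Proof.
by move=> uj; apply/matrixP => x y; rewrite !ord1 mulmx_rowv uj mulr0 mxE.
Qed.

Lemma row_mul_colv0 i r v : v 0 i = 0 -> v *m colv i r = 0.
Proof.
by move=> vi; apply/matrixP => x y; rewrite !ord1 mulmx_colv vi mul0r mxE.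
Qed.

Lemma colvD i r s : colv i r + colv i s = colv i (r + s).
Proof. by rewrite /colv scalerDl. Qed.

Lemma rowvD i r s : rowv i r + rowv i s = rowv i (r + s).
Proof. by rewrite /rowv scalerDl. Qed.

Lemma colv0 i : colv i 0 = 0. Proof. exact: scale0r. Qed.
Lemma rowv0 i : rowv i 0 = 0. Proof. exact: scale0r. Qed.

Lemma colv_mul_rowv i j r s : colv i r *m rowv j s = colv i (r * s) *m rowv j 1.
Proof.
apply/matrixP => x y; rewrite !mulmx_col_row !colvE !rowvE.
by case: eqP; case: eqP; rewrite ?(mulr0, mul0r, mulr1).
Qed.

Lemma cV_split u k : u = (u - colv k (u k 0)) + colv k (u k 0).
Proof. by rewrite subrK. Qed.

(** The matrix [1 + u v], meant for [v u = 0].  Elementary matrices are of this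
    form and, unlike them, these matrices are permuted by conjugation, which
    makes every relation needed below an instance of [transvectionMl],
    [transvectionMr] or [transvectionJ]. *)
Definition transvection u v : GLn R n :=
  insubd (1%g : GLn R n) (1%:M + u *m v, 1%:M - u *m v).

Lemma GLn_mxM g h : GLn_mx (g * h)%g = GLn_mx g *m GLn_mx h. Proof. by []. Qed.
Lemma GLn_mxMV g : GLn_mx g *m GLn_mx g^-1%g = 1%:M. Proof. exact: GLn_mxK. Qed.
Lemma GLn_mxVM g : GLn_mx g^-1%g *m GLn_mx g = 1%:M. Proof. exact: GLn_mxVK. Qed.

Lemma transvectionE u v : v *m u = 0 ->
  GLn_mx (transvection u v) = 1%:M + u *m v.
Proof.
move=> vu; rewrite /GLn_mx val_insubd.
rewrite /mutually_inverse_mx /= !mulmxDl !mulmxDr !mul1mx !mulmxN !mulNmx !mulmx1.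
rewrite !mulmxA -(mulmxA u v u) vu mulmx0 mul0mx !oppr0 !addr0.
by rewrite subrK addrK eqxx.
Qed.

Lemma eq_transvection u v u' v' : u *m v = u' *m v' ->
  transvection u v = transvection u' v'.
Proof. by rewrite /transvection => ->. Qed.

Lemma transvectionMl u u' v : v *m u = 0 -> v *m u' = 0 ->
  (transvection u v * transvection u' v)%g = transvection (u + u') v.
Proof.
move=> vu vu'; apply: GLn_mx_inj.
have vuu' : v *m (u + u') = 0 by rewrite mulmxDr vu vu' addr0.
rewrite GLn_mxM !transvectionE //.
rewrite !mulmxDl !mulmxDr !mulmx1 !mul1mx mulmxA -(mulmxA u v u') vu' mulmx0 mul0mx.
by rewrite addr0 -addrA (addrC (u' *m v)).
Qed.

Lemma transvectionMr u v v' : v *m u = 0 -> v' *m u = 0 ->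
  (transvection u v * transvection u v')%g = transvection u (v + v').
Proof.
move=> vu vu'; apply: GLn_mx_inj.
have vvu : (v + v') *m u = 0 by rewrite mulmxDl vu vu' addr0.
rewrite GLn_mxM !transvectionE //.
rewrite !mulmxDl !mulmxDr !mulmx1 !mul1mx mulmxA -(mulmxA u v u) vu mulmx0 mul0mx.
by rewrite addr0 -addrA (addrC (u *m v')).
Qed.

Lemma transvection0l v : transvection 0 v = 1%g.
Proof.
by apply: GLn_mx_inj; rewrite transvectionE ?mul0mx ?mulmx0 ?addr0.
Qed.

Lemma transvection0r u : transvection u 0 = 1%g.
Proof.
by apply: GLn_mx_inj; rewrite transvectionE ?mul0mx ?mulmx0 ?addr0.
Qed.

Lemma transvectionV u v : v *m u = 0 -> (transvection u v)^-1%g = transvection (- u) v.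
Proof.
move=> vu; apply: mulg1_eq; rewrite transvectionMl ?mulmxN ?vu ?oppr0 //.
by rewrite subrr transvection0l.
Qed.

Lemma transvectionJ g u v : v *m u = 0 -> (g * transvection u v * g^-1)%g =
  transvection (GLn_mx g *m u) (v *m GLn_mx g^-1%g).
Proof.
move=> vu; apply: GLn_mx_inj; rewrite !GLn_mxM !transvectionE //; last first.
  by rewrite mulmxA -(mulmxA v) GLn_mxVM mulmx1.
by rewrite mulmxDr mulmx1 mulmxDl GLn_mxMV !mulmxA.
Qed.

(** * Elementary matrices *)

Definition elem i j r := transvection (colv i r) (rowv j 1).

Lemma elem_row i j r : elem i j r = transvection (colv i 1) (rowv j r).
Proof. by apply: eq_transvection; rewrite [RHS]colv_mul_rowv mul1r. Qed.

Lemma rowv_colv0 i j r s : i != j -> rowv j r *m colv i s = 0.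
Proof. by move=> ij; apply: rowv_mul_col0; rewrite colvE eq_sym (negbTE ij). Qed.

Lemma elemE i j r : i != j -> GLn_mx (elem i j r) = elementary_mx i j r.
Proof.
move=> ij; rewrite transvectionE ?rowv_colv0 // /elementary_mx; congr (_ + _).
apply/matrixP => x y; rewrite mulmx_col_row colvE rowvE !mxE.
by case: eqP; case: eqP; rewrite ?(mulr0, mul0r, mulr1).
Qed.

Lemma elemD i j r s : i != j -> (elem i j r * elem i j s)%g = elem i j (r + s).
Proof.
by move=> ij; rewrite transvectionMl ?rowv_colv0 // colvD.
Qed.

Lemma elem0 i j : elem i j 0 = 1%g.
Proof. by rewrite /elem colv0 transvection0l. Qed.

Lemma elemV i j r : i != j -> (elem i j r)^-1%g = elem i j (- r).
Proof. by move=> ij; apply: mulg1_eq; rewrite elemD // subrr elem0. Qed.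

Lemma elemX i j r m : i != j -> (elem i j r ^+ m)%g = elem i j (r *+ m).
Proof.
move=> ij; elim: m => [|m IHm]; first by rewrite expg0 mulr0n elem0.
by rewrite expgS IHm elemD // mulrS.
Qed.

Lemma elem_mul_col i j r u : i != j ->
  GLn_mx (elem i j r) *m u = u + colv i (r * u j 0).
Proof.
move=> ij; rewrite transvectionE ?rowv_colv0 // mulmxDl mul1mx -mulmxA.
congr (_ + _); apply/matrixP => x y; rewrite !ord1 mulmx_col_row mulmx_rowv mul1r !colvE.
by case: eqP; rewrite ?mul0r.
Qed.

Lemma elem_mul_row i j r v : i != j ->
  v *m GLn_mx (elem i j r) = v + rowv j (v 0 i * r).
Proof.
move=> ij; rewrite transvectionE ?rowv_colv0 // mulmxDr mulmx1 mulmxA.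
congr (_ + _); apply/matrixP => x y; rewrite !ord1 mulmx_col_row mulmx_colv !rowvE.
by case: eqP; rewrite ?mulr1 ?mulr0.
Qed.

Lemma commg_elem i j k a b : i != j -> j != k -> i != k ->
  [~ elem i j a, elem j k b]%g = elem i k (a * b).
Proof.
move=> ij jk ik; rewrite commgEl; have -> : (elem i j a ^ elem j k b)%g
    = ((elem j k b)^-1 * elem i j a * ((elem j k b)^-1)^-1)%g by rewrite invgK conjgE mulgA.
rewrite transvectionJ ?rowv_colv0 // invgK elemV // elem_mul_col //.
rewrite colvE (negbTE (_ : k != i)) 1?eq_sym // mulr0 colv0 addr0.
rewrite elem_mul_row // rowvE eqxx mul1r.
rewrite -transvectionMr ?rowv_colv0 // mulKg.
by apply: eq_transvection; rewrite colv_mul_rowv.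
Qed.

Lemma commute_elem_row i j k a b : i != j -> i != k ->
  commute (elem i j a) (elem i k b).
Proof.
move=> ij ik; rewrite /commute !elem_row !transvectionMr ?rowv_colv0 //.
by rewrite addrC.
Qed.

Lemma commute_elem_col i j k a b : i != k -> j != k ->
  commute (elem i k a) (elem j k b).
Proof.
move=> ik jk; rewrite /commute /elem !transvectionMl ?rowv_colv0 //.
by rewrite addrC.
Qed.

Lemma elem_in i j r : i != j -> elementary_group R n (elem i j r).
Proof. by move=> ij H [_]; apply; exists i, j, r; split=> //; exact: elemE. Qed.

Lemma elementary_subgroup : is_subgroup (elementary_group R n).
Proof. exact: smallest_subgroup. Qed.

Lemma elementary_group_sub (H : set (GLn R n)) : is_subgroup H ->
  (forall i j r, i != j -> H (elem i j r)) -> elementary_group R n `<=` H.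
Proof.
move=> sH Hel; apply: smallest_sub => // g [i [j [r [ij eg]]]].
have -> : g = elem i j r by apply: GLn_mx_inj; rewrite eg elemE.
exact: Hel.
Qed.

(** A transvection along a single row or column is a product of commuting
    elementary matrices. *)
Lemma col_transvection_in (H : set (GLn R n)) k c : is_subgroup H -> c k 0 = 0 ->
  (forall i, i != k -> H (elem i k (c i 0))) -> H (transvection c (rowv k 1)).
Proof.
move=> sH ck Hc.
have -> : c = \sum_(i <- index_enum 'I_n | i != k) colv i (c i 0).
  apply/matrixP => x y; rewrite !ord1 summxE big_mkcond /=.
  rewrite (bigD1 x) //= big1 => [|i ix].
    by rewrite addr0 colvE eqxx; case: eqP => [->|].
  by case: ifP => // _; rewrite colvE eq_sym (negbTE ix).
suff [] : H (transvection (\sum_(i <- index_enum 'I_n | i != k) colv i (c i 0)) (rowv k 1))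
  /\ (\sum_(i <- index_enum 'I_n | i != k) colv i (c i 0)) k 0 = 0 by [].
elim: (index_enum _) => [|i s [IH1 IH2]].
  by rewrite big_nil transvection0l mxE; split=> //; exact: subgroup1.
rewrite big_cons; case: ifP => // ik; split.
  rewrite -transvectionMl ?rowv_colv0 //; last exact: rowv_mul_col0.
  by apply: subgroupM => //; exact: Hc.
by rewrite mxE colvE eq_sym (negbTE ik) add0r.
Qed.

Lemma row_transvection_in (H : set (GLn R n)) k v : is_subgroup H -> v 0 k = 0 ->
  (forall j, k != j -> H (elem k j (v 0 j))) -> H (transvection (colv k 1) v).
Proof.
move=> sH vk Hv.
have -> : v = \sum_(i <- index_enum 'I_n | k != i) rowv i (v 0 i).
  apply/matrixP => x y; rewrite !ord1 summxE big_mkcond /=.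
  rewrite (bigD1 y) //= big1 => [|i iy].
    by rewrite addr0 rowvE eqxx; case: eqP => [<-|].
  by case: ifP => // _; rewrite rowvE eq_sym (negbTE iy).
suff [] : H (transvection (colv k 1) (\sum_(i <- index_enum 'I_n | k != i) rowv i (v 0 i)))
  /\ (\sum_(i <- index_enum 'I_n | k != i) rowv i (v 0 i)) 0 k = 0 by [].
elim: (index_enum _) => [|i s [IH1 IH2]].
  by rewrite big_nil transvection0r mxE; split=> //; exact: subgroup1.
rewrite big_cons; case: ifP => // ki; split.
  rewrite -transvectionMr ?rowv_colv0 //; last exact: row_mul_colv0.
  by apply: subgroupM => //; rewrite -elem_row; exact: Hv.
by rewrite mxE rowvE (negbTE ki) add0r.
Qed.

(** For such a [g], conjugation preserves both the root subgroups of the [k]-th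
    row and those of the [k]-th column. *)
Definition fixes k g :=
  GLn_mx g *m colv k 1 = colv k 1 /\ rowv k 1 *m GLn_mx g = rowv k 1.

Lemma fixes_subgroup k : is_subgroup (fixes k).
Proof.
apply: is_subgroupI => [|g h [gc gr] [hc hr]|g [gc gr]].
- by split; rewrite ?mulmx1 ?mul1mx.
- by split; rewrite GLn_mxM; [rewrite -mulmxA hc|rewrite mulmxA gr].
- by split; [rewrite -{1}gc mulmxA GLn_mxVM mul1mx|rewrite -{1}gr -mulmxA GLn_mxMV mulmx1].
Qed.

Lemma fixesV k g : fixes k g -> fixes k g^-1%g.
Proof. by move=> kg; apply: subgroupV => //; exact: fixes_subgroup. Qed.

Lemma fixes_elem k i j r : i != j -> k != i -> k != j -> fixes k (elem i j r).
Proof.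
move=> ij ki kj; split.
  by rewrite elem_mul_col // colvE eq_sym (negbTE kj) mulr0 colv0 addr0.
by rewrite elem_mul_row // rowvE eq_sym (negbTE ki) mul0r rowv0 addr0.
Qed.

Lemma fixes_col k g i : fixes k g -> GLn_mx g i k = (i == k)%:R.
Proof.
move=> [/matrixP/(_ i 0)]; rewrite mulmx_colv mulr1 colvE => -> _.
by case: eqP.
Qed.

Lemma fixes_row k g j : fixes k g -> GLn_mx g k j = (j == k)%:R.
Proof.
move=> [_ /matrixP/(_ 0 j)]; rewrite mulmx_rowv mul1r rowvE => ->.
by case: eqP.
Qed.

End Transvections.

(** * Finiteness of the elementary group modulo a congruence subgroup *)

Section Decomposition.
Variables (R : nzRingType) (n : nat) (I : set R).
Hypotheses (idI : two_sided_ideal I) (finI : ideal_finite_index I).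
Variables (N : set (GLn R n)) (o0 o1 o2 : 'I_n).
Hypotheses (o01 : o0 != o1) (o02 : o0 != o2) (o12 : o1 != o2).
Variable A : set (GLn R n).
Hypotheses (defA : A = elementary_group R n) (sN : is_subgroup N) (NA : N `<=` A).
Hypothesis N_normal : forall x g, N x -> A g -> N (x ^ g)%g.
Hypothesis N_elem : forall i j r, i != j -> I r -> N (elem i j r).
Implicit Types (u c : 'cV[R]_n) (v w : 'rV[R]_n) (g h l : GLn R n).
Implicit Types (a b r s t : R) (i j k : 'I_n).

Let e0 : 'rV[R]_n := rowv o0 1.
Let e0' : 'cV[R]_n := colv o0 1.

Let sA : is_subgroup A. Proof. by rewrite defA; exact: elementary_subgroup. Qed.
Let A_elem i j r : i != j -> A (elem i j r).
Proof. by rewrite defA; exact: elem_in. Qed.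
Let A_sub H : is_subgroup H -> (forall i j r, i != j -> H (elem i j r)) -> A `<=` H.
Proof. by rewrite defA; exact: elementary_group_sub. Qed.

Let o10 : o1 != o0. Proof. by rewrite eq_sym. Qed.
Let o20 : o2 != o0. Proof. by rewrite eq_sym. Qed.
Let o21 : o2 != o1. Proof. by rewrite eq_sym. Qed.

Definition mx_in m p (B : 'M[R]_(m, p)) := forall x y, I (B x y).

Let mx_inMl m p q (B : 'M[R]_(m, p)) (C : 'M[R]_(p, q)) : mx_in C -> mx_in (B *m C).
Proof. by move=> IC i j; rewrite mxE; apply: ideal_sum => // k _; exact: ideal_mull. Qed.

Let mx_inMr m p q (B : 'M[R]_(m, p)) (C : 'M[R]_(p, q)) : mx_in B -> mx_in (B *m C).
Proof. by move=> IB i j; rewrite mxE; apply: ideal_sum => // k _; exact: ideal_mulr. Qed.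

Let col_in_N k c : c k 0 = 0 -> mx_in c -> N (transvection c (rowv k 1)).
Proof. by move=> ck Ic; apply: col_transvection_in => // i ik; exact: N_elem. Qed.

Let row_in_N k v : v 0 k = 0 -> mx_in v -> N (transvection (colv k 1) v).
Proof. by move=> vk Iv; apply: row_transvection_in => // i ik; exact: N_elem. Qed.

(** ** Elements central modulo [N] *)

(** The inverse image of the center of [A / N]. *)
Definition Z := [set g | A g /\ forall x, A x -> N [~ g, x]%g].

Let sZ : is_subgroup Z.
Proof.
apply: is_subgroupI => [|g h [Ag Zg] [Ah Zh]|g [Ag Zg]].
- by split; [exact: subgroup1|move=> x _; rewrite comm1g; exact: subgroup1].
- split=> [|x Ax]; first exact: subgroupM.
  have -> : [~ g * h, x]%g = ([~ g, x] ^ h * [~ h, x])%g by group_simp.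
  by apply: subgroupM => //; [apply: N_normal => //; exact: Zg|exact: Zh].
- split=> [|x Ax]; first exact: subgroupV.
  have -> : [~ g^-1, x]%g = ([~ g, x]^-1 ^ g^-1)%g by group_simp.
  apply: N_normal; last exact: subgroupV.
  by apply: subgroupV => //; exact: Zg.
Qed.

Let ZA : Z `<=` A. Proof. by move=> g []. Qed.

Let NZ : N `<=` Z.
Proof.
move=> g Ng; split=> [|x Ax]; first exact: NA.
by rewrite commgEl; apply: subgroupM => //; [exact: subgroupV|exact: N_normal].
Qed.

Let Z_normal g x : Z g -> A x -> Z (g ^ x)%g.
Proof.
move=> [Ag Zg] Ax; split=> [|y Ay]; first exact: subgroupJ.
have -> : [~ g ^ x, y]%g = ([~ g, y ^ x^-1] ^ x)%g by group_simp.
by apply: N_normal => //; apply: Zg; apply: subgroupJ => //; exact: subgroupV.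
Qed.

(** The root subgroups of the [k]-th row and of the [k]-th column generate [A],
    and a matrix fixing the [k]-th coordinate acts on them by conjugation; modulo
    [N] this action only depends on its entries modulo [I].  The same argument
    shows that the kernel of a stable Steinberg group is central. *)
Lemma fixes_central k g : A g -> fixes k g -> mx_in (GLn_mx g - 1%:M) -> Z g.
Proof.
move=> Ag kg Ig; split=> // x Ax.
pose B := [set x | A x /\ N [~ g, x]%g].
suff AB : A `<=` B by case: (AB _ Ax).
have sB : is_subgroup B.
  apply: is_subgroupI => [|y z [Ay Ny] [Az Nz]|y [Ay Ny]].
  - by split; [exact: subgroup1|rewrite commg1; exact: subgroup1].
  - split; first exact: subgroupM.
    have -> : [~ g, y * z]%g = ([~ g, z] * [~ g, y] ^ z)%g by group_simp.
    by apply: subgroupM => //; exact: N_normal.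
  - split; first exact: subgroupV.
    have -> : [~ g, y^-1]%g = ([~ g, y]^-1 ^ y^-1)%g by group_simp.
    by apply: N_normal; [exact: subgroupV|exact: subgroupV].
have Ig' : mx_in (GLn_mx g^-1%g - 1%:M).
  have -> : GLn_mx g^-1%g - 1%:M = - (GLn_mx g^-1%g *m (GLn_mx g - 1%:M)).
    by rewrite mulmxBr GLn_mxVM mulmx1 opprB.
  by move=> i j; rewrite mxE; apply: ideal_opp => //; exact: mx_inMl.
have Bconj y : A y -> N (y^-1 * (g^-1 * y * g^-1^-1))%g -> B y.
  move=> Ay Ny; split=> //; rewrite -invgR; apply: subgroupV => //.
  by move: Ny; rewrite invgK commgEl conjgE !mulgA.
have kg' := fixesV kg.
have Bcol i a : i != k -> B (elem i k a).
  move=> ik; apply: Bconj; first exact: A_elem.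
  have g'ik : (GLn_mx g^-1%g *m colv i a) k 0 = 0.
    by rewrite mulmx_colv fixes_row // (negbTE ik) mul0r.
  rewrite transvectionJ ?rowv_colv0 // invgK kg.2 elemV // transvectionMl ?rowv_colv0 //.
    apply: col_in_N.
      by rewrite mxE colvE eq_sym (negbTE ik) add0r g'ik.
    have -> : colv i (- a) + GLn_mx g^-1%g *m colv i a
        = (GLn_mx g^-1%g - 1%:M) *m colv i a.
      by rewrite mulmxBl mul1mx addrC /colv scaleNr.
    exact: mx_inMr.
  exact: rowv_mul_col0.
have Brow j a : k != j -> B (elem k j a).
  move=> kj; apply: Bconj; first exact: A_elem.
  have gkj : (rowv j a *m GLn_mx g) 0 k = 0.
    by rewrite mulmx_rowv fixes_col // eq_sym (negbTE kj) mulr0.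
  rewrite elemV // !elem_row transvectionJ ?rowv_colv0 // invgK kg'.1.
  rewrite transvectionMr ?rowv_colv0 //.
    apply: row_in_N.
      by rewrite mxE rowvE (negbTE kj) add0r gkj.
    have -> : rowv j (- a) + rowv j a *m GLn_mx g = rowv j a *m (GLn_mx g - 1%:M).
      by rewrite mulmxBr mulmx1 addrC /rowv scaleNr.
    exact: mx_inMl.
  exact: row_mul_colv0.
apply: A_sub => // i j a ij.
have [eik|ik] := eqVneq i k; first by rewrite eik; apply: Brow; rewrite -eik.
have [ejk|jk] := eqVneq j k; first by rewrite ejk; exact: Bcol.
have kj : k != j by rewrite eq_sym.
by rewrite -[a]mulr1 -(commg_elem _ _ ik kj ij); apply: subgroupR; [|exact: Bcol|exact: Brow].
Qed.

(* As [R / I] is finite, so is the set of matrices with entries read modulo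
   [I]. *)
Let finite_classes (S : set (GLn R n)) :
  (forall g h, S g -> S h -> mx_in (GLn_mx h - GLn_mx g) -> Z (g^-1 * h)%g) ->
  finite_mod Z S.
Proof.
move=> SZ; have [F [p pP]] := ideal_class idI finI.
apply: (@finite_mod_invariant _ _ _ {ffun 'I_n * 'I_n -> F}
  (fun g => [ffun ij => p (GLn_mx g ij.1 ij.2)])).
move=> g h Sg Sh /ffunP e; apply: SZ => // x y.
by rewrite !mxE; apply/pP; have := e (x, y); rewrite !ffunE.
Qed.

Let finite_fixes k : finite_mod Z [set g | A g /\ fixes k g].
Proof.
apply: finite_classes => g h [Ag kg] [Ah kh] Igh.
apply: (@fixes_central k).
- by apply: subgroupM => //; exact: subgroupV.
- by apply: subgroupM => //; [exact: fixes_subgroup|exact: fixesV].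
have -> : GLn_mx (g^-1 * h)%g - 1%:M = GLn_mx g^-1%g *m (GLn_mx h - GLn_mx g).
  by rewrite mulmxBr GLn_mxVM.
exact: mx_inMl.
Qed.

(** ** The generalized Gauss decomposition *)

(** The factors of the decomposition.  [torus] replaces the matrices that are
    diagonal modulo [I]: its elements differ from the identity only in the block
    of the coordinates [o0] and [o1], and the two congruences are the form of
    diagonality that passes to products without inverting entries. *)
Definition lower := [set transvection c e0 | c in [set c : 'cV[R]_n | c o0 0 = 0]].
Definition upper := [set transvection e0' v | v in [set v : 'rV[R]_n | v 0 o0 = 0]].
Definition torus := [set h | [/\ A h, forall k, k != o0 -> k != o1 -> fixes k h,
  I (GLn_mx h o1 o0) & I (GLn_mx h^-1%g o0 o1)]].
Definition parabolic := [set g | A g /\ e0 *m GLn_mx g = e0].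
Definition parabolic_mod := [set (g * x)%g | g in parabolic & x in N].
Let P := parabolic_mod.

Let lower_A c : c o0 0 = 0 -> A (transvection c e0).
Proof. by move=> c0; apply: col_transvection_in => // i; exact: A_elem. Qed.

Let upper_A v : v 0 o0 = 0 -> A (transvection e0' v).
Proof. by move=> v0; apply: row_transvection_in => // i; exact: A_elem. Qed.

Let finite_lower : finite_mod Z lower.
Proof.
apply: finite_classes => _ _ [c c0 <-] [c' c'0 <-].
have e0c : e0 *m c = 0 by exact: rowv_mul_col0.
have e0c' : e0 *m c' = 0 by exact: rowv_mul_col0.
rewrite transvectionV // transvectionMl ?mulmxN ?e0c ?oppr0 // !transvectionE // => Icc'.
apply: NZ; apply: col_in_N; first by rewrite !mxE c0 c'0 oppr0 addr0.
move=> x y; have := Icc' x o0; rewrite !ord1 !mxE !big_ord1 !rowvE eqxx !mulr1.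
by rewrite opprD addrACA subrr add0r addrC.
Qed.

Let finite_upper : finite_mod Z upper.
Proof.
apply: finite_classes => _ _ [v v0 <-] [v' v'0 <-].
have ve0 : v *m e0' = 0 by exact: row_mul_colv0.
have v'e0 : v' *m e0' = 0 by exact: row_mul_colv0.
have -> : (transvection e0' v)^-1%g = transvection e0' (- v).
  by rewrite transvectionV //; apply: eq_transvection; rewrite mulNmx mulmxN.
rewrite transvectionMr ?mulNmx ?ve0 ?oppr0 // !transvectionE // => Ivv'.
apply: NZ; apply: row_in_N; first by rewrite !mxE v0 v'0 oppr0 addr0.
move=> x y; have := Ivv' o0 y; rewrite !ord1 !mxE !big_ord1 !colvE eqxx !mul1r.
by rewrite opprD addrACA subrr add0r addrC.
Qed.

Let parabolic_subgroup : is_subgroup parabolic.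
Proof.
apply: is_subgroupI => [|g h [Ag Pg] [Ah Ph]|g [Ag Pg]].
- by split; [exact: subgroup1|rewrite mulmx1].
- by split; [exact: subgroupM|rewrite GLn_mxM mulmxA Pg].
- by split; [exact: subgroupV|rewrite -{1}Pg -mulmxA GLn_mxMV mulmx1].
Qed.

Let parabolic_lower g : parabolic g ->
  exists c h, [/\ c o0 0 = 0, A h, fixes o0 h & g = (transvection c e0 * h)%g].
Proof.
move=> [Ag Pg]; pose c := GLn_mx g *m e0' - e0'.
have c0 : c o0 0 = 0.
  have /matrixP/(_ 0 o0) := Pg; rewrite mulmx_rowv mul1r rowvE eqxx => g00.
  by rewrite mxE mulmx_colv g00 mulr1 mxE colvE eqxx subrr.
have e0c : e0 *m c = 0 by exact: rowv_mul_col0.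
exists c, ((transvection c e0)^-1 * g)%g; split=> //; last by rewrite mulgA mulgV mul1g.
  by apply: subgroupM => //; apply: subgroupV => //; exact: lower_A.
rewrite transvectionV //; have e0nc : e0 *m - c = 0 by rewrite mulmxN e0c oppr0.
split; rewrite GLn_mxM transvectionE //.
  rewrite -mulmxA mulmxDl mul1mx -mulmxA (mulmxA e0) Pg.
  have -> : e0 *m colv o0 1 = 1%:M.
    apply/matrixP => x y; rewrite !ord1 mulmx_rowv mul1r colvE eqxx mxE.
    by rewrite eqxx.
  by rewrite mulmx1 /c opprB addrC subrK.
by rewrite mulmxA mulmxDr mulmx1 mulmxA e0nc mul0mx addr0.
Qed.

Let P_N x : N x -> P x.
Proof. by move=> Nx; exists 1%g; [exact: subgroup1|exists x; rewrite ?mul1g]. Qed.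

Let P_parabolic x : parabolic x -> P x.
Proof. by move=> Px; exists x => //; exists 1%g; [exact: subgroup1|rewrite mulg1]. Qed.

Let P_A x : P x -> A x.
Proof. by move=> [y [Ay _]] [z /NA Az <-]; exact: subgroupM. Qed.

Let P_subgroup : is_subgroup P.
Proof.
apply: is_subgroupI => [|_ _ [g Pg [x Nx <-]] [h Ph [y Ny <-]]|_ [g Pg [x Nx <-]]].
- by apply: P_N; exact: subgroup1.
- exists (g * h)%g; first exact: subgroupM.
  exists (x ^ h * y)%g; last by group_simp.
  by apply: subgroupM => //; apply: N_normal => //; case: Ph.
- exists g^-1%g; first exact: subgroupV.
  exists (x^-1 ^ g^-1)%g; last by group_simp.
  by apply: N_normal; [exact: subgroupV|apply: subgroupV => //; case: Pg].
Qed.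

Let torusM h l : torus h -> torus l -> torus (h * l)%g.
Proof.
move=> [Ah fh h10 h01] [Al fl l10 l01]; split.
- exact: subgroupM.
- by move=> i i0 i1; apply: subgroupM; [exact: fixes_subgroup|exact: fh|exact: fl].
- rewrite GLn_mxM mxE; apply: ideal_sum => // i _; have [->|i0] := eqVneq i o0.
    exact: ideal_mulr.
  have [->|i1] := eqVneq i o1; first exact: ideal_mull.
  by rewrite (fixes_row _ (fl _ i0 i1)) eq_sym (negbTE i0) mulr0; exact: ideal_zero.
- rewrite invgM GLn_mxM mxE; apply: ideal_sum => // i _; have [->|i0] := eqVneq i o0.
    exact: ideal_mull.
  have [->|i1] := eqVneq i o1; first exact: ideal_mulr.
  rewrite (fixes_col _ (fixesV (fl _ i0 i1))) eq_sym (negbTE i0) mul0r; exact: ideal_zero.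
Qed.

Let P_conj_subgroup h : is_subgroup [set x | P (x ^ h)%g].
Proof.
apply: is_subgroupI => [|x y Px Py|x Px] /=.
- by rewrite conj1g; exact: subgroup1.
- by rewrite conjMg; exact: subgroupM.
- by rewrite conjVg; exact: subgroupV.
Qed.

(** Conjugates under the torus of the generators of the parabolic subgroup stay
    in it: exactly for transvections [1 + u v] with [u] vanishing at [o0] and
    [o1], and up to a factor in [N] for the elementary matrices in row [o1]. *)
Let P_torus_far h u v : torus h -> A (transvection u v) -> v *m u = 0 ->
  u o0 0 = 0 -> u o1 0 = 0 -> P (transvection u v ^ h)%g.
Proof.
move=> [Ah fh _ _] Auv vu u0 u1; apply: P_parabolic; split; first exact: subgroupJ.
have hu : GLn_mx h^-1%g *m u = u.
  apply/matrixP => x y; rewrite !ord1 mxE (bigD1 x) //= big1 => [|i ix].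
    have [->|x0] := eqVneq x o0; first by rewrite u0 mulr0 addr0.
    have [->|x1] := eqVneq x o1; first by rewrite u1 mulr0 addr0.
    by rewrite (fixes_row _ (fixesV (fh _ x0 x1))) eqxx mul1r addr0.
  have [->|i0] := eqVneq i o0; first by rewrite u0 mulr0.
  have [->|i1] := eqVneq i o1; first by rewrite u1 mulr0.
  by rewrite (fixes_col _ (fixesV (fh _ i0 i1))) eq_sym (negbTE ix) mul0r.
have -> : (transvection u v ^ h)%g = (h^-1 * transvection u v * h^-1^-1)%g.
  by rewrite invgK conjgE mulgA.
have vhu : (v *m GLn_mx h) *m u = 0.
  by rewrite -hu -mulmxA (mulmxA _ _ u) GLn_mxMV mul1mx.
rewrite transvectionJ // invgK hu transvectionE // mulmxDr mulmx1 mulmxA.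
by rewrite (rowv_mul_col0 1 u0) mul0mx addr0.
Qed.

Let P_torus_near h j a : torus h -> j != o0 -> j != o1 -> P (elem o1 j a ^ h)%g.
Proof.
move=> [Ah fh _ h01] j0 j1; have fj := fh _ j0 j1.
have o1j : o1 != j by rewrite eq_sym.
have o0j : o0 != j by rewrite eq_sym.
have -> : (elem o1 j a ^ h)%g = (h^-1 * elem o1 j a * h^-1^-1)%g.
  by rewrite invgK conjgE mulgA.
rewrite transvectionJ ?rowv_colv0 // invgK fj.2.
set u := _ *m colv o1 a.
have uj : u j 0 = 0.
  by rewrite /u mulmx_colv (fixes_row _ (fixesV fj)) (negbTE o1j) mul0r.
have Iu : I (u o0 0) by rewrite /u mulmx_colv; exact: ideal_mulr.
rewrite {}/u in uj Iu *; move: (_ *m _) uj Iu => u uj Iu.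
rewrite [u](cV_split u o0) -transvectionMl ?rowv_colv0 //; last first.
  by apply: rowv_mul_col0; rewrite !mxE uj (negbTE j0) mulr0 subr0.
apply: subgroupM => //; last by apply: P_N; exact: N_elem.
have u'j : (u - colv o0 (u o0 0)) j 0 = 0.
  by rewrite mxE uj mxE colvE (negbTE j0) subr0.
apply: P_parabolic; split.
  by apply: col_transvection_in => // i ij; exact: A_elem.
rewrite transvectionE ?rowv_mul_col0 // mulmxDr mulmx1 mulmxA.
by rewrite rowv_mul_col0 ?mul0mx ?addr0 // mxE [X in _ + X]mxE colvE eqxx subrr.
Qed.

Definition gauss := [set g | exists c v h p, [/\ c o0 0 = 0, v 0 o0 = 0, torus h,
  P p & g = (transvection c e0 * transvection e0' v * h * p)%g]].
Let Y := gauss.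

Let Y_lower c g : c o0 0 = 0 -> Y g -> Y (transvection c e0 * g)%g.
Proof.
move=> c0 [c' [v [h [p [c'0 v0 Hh Pp ->]]]]]; exists (c + c'), v, h, p; split=> //.
  by rewrite mxE c0 c'0 addr0.
by rewrite !mulgA transvectionMl ?rowv_mul_col0.
Qed.

Let Y_fixes l g : A l -> fixes o0 l -> (forall h, torus h -> P (l ^ h)%g) ->
  Y g -> Y (l * g)%g.
Proof.
move=> Al fl Pl [c [v [h [p [c0 v0 Hh Pp ->]]]]].
have fl' := fixesV fl.
exists (GLn_mx l *m c), (v *m GLn_mx l^-1%g), h, (l ^ h * p)%g; split=> //.
- rewrite mxE big1 // => i _; have [->|i0] := eqVneq i o0; first by rewrite c0 mulr0.
  by rewrite (fixes_row _ fl) (negbTE i0) mul0r.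
- rewrite mxE big1 // => i _; have [->|i0] := eqVneq i o0; first by rewrite v0 mul0r.
  by rewrite (fixes_col _ fl') (negbTE i0) mulr0.
- by apply: subgroupM => //; exact: Pl.
have e0c : e0 *m c = 0 by exact: rowv_mul_col0.
have ve0 : v *m e0' = 0 by exact: row_mul_colv0.
have -> : transvection (GLn_mx l *m c) e0 = (l * transvection c e0 * l^-1)%g.
  by rewrite transvectionJ // fl'.2.
have -> : transvection e0' (v *m GLn_mx l^-1%g) = (l * transvection e0' v * l^-1)%g.
  by rewrite transvectionJ // fl.1.
by group_simp.
Qed.

(** The rank one computation.  The element [m] lives in the block of [o0], [o1].
    By the stable rank condition [tau] can be chosen to make the entry [D o0 o0]
    of its inverse [D] right invertible modulo [I], with inverse [y]; then [a]
    and [b] clear the entries that prevent [m] from being in the torus. *)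
Let Y_upper_lower s t v h p : v 0 o0 = 0 -> torus h -> P p ->
  Y (elem o0 o1 s * elem o1 o0 t * transvection e0' v * h * p)%g.
Proof.
move=> v0 Hh Pp; pose v1 : R := v 0 o1; pose v2 := v - rowv o1 v1.
have v20 : v2 0 o0 = 0 by rewrite mxE v0 mxE rowvE (negbTE o01) subr0.
have v21 : v2 0 o1 = 0 by rewrite mxE [X in _ + X]mxE rowvE eqxx subrr.
have -> : transvection e0' v = (elem o0 o1 v1 * transvection e0' v2)%g.
  rewrite elem_row transvectionMr ?rowv_colv0 //; last exact: row_mul_colv0.
  by rewrite addrC subrK.
clearbody v2 v1.
have unimodular : I ((1 + v1 * t) * (1 + s * t)
    + ((1 + v1 * t) * s + v1) * - t - 1).
  have -> : (1 + v1 * t) * (1 + s * t) + ((1 + v1 * t) * s + v1) * - t - 1 = 0 by nc_ring.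
  exact: ideal_zero.
have [tau [y Iy]] := stable_rank_one idI finI unimodular.
have [m mE] : exists m,
  m = (elem o1 o0 tau * elem o0 o1 s * elem o1 o0 t * elem o0 o1 v1)%g by eexists.
have Am : A m by rewrite mE; do ?apply: subgroupM => //; exact: A_elem.
have fm k : k != o0 -> k != o1 -> fixes k m.
  by move=> k0 k1; rewrite mE; do ?apply: subgroupM; try exact: fixes_subgroup; exact: fixes_elem.
have [D DE] : exists D, D = GLn_mx m^-1%g by eexists.
have D0 : e0 *m D = rowv o0 ((1 + v1 * t) + ((1 + v1 * t) * s + v1) * tau)
    + rowv o1 (- ((1 + v1 * t) * s + v1)).
  rewrite DE mE /e0 !invgM !elemV // !GLn_mxM.
  rewrite mulmxA elem_mul_row // rowvE eqxx mul1r.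
  rewrite mulmxA elem_mul_row // mxE !rowvE (negbTE o10) eqxx add0r addrAC rowvD.
  rewrite mulmxA (elem_mul_row (- s)) // mxE !rowvE eqxx (negbTE o01) addr0 -addrA rowvD.
  rewrite elem_mul_row // mxE !rowvE (negbTE o10) eqxx add0r addrAC rowvD.
  by congr (rowv _ _ + rowv _ _); nc_ring.
have D00 : D o0 o0 = (1 + v1 * t) + ((1 + v1 * t) * s + v1) * tau.
  have /matrixP/(_ 0 o0) := D0; rewrite /e0.
  by rewrite mulmx_rowv mul1r => ->; rewrite mxE !rowvE eqxx (negbTE o01) addr0.
move: Iy; rewrite -{}D00 {D0} => Iy.
pose a := - (y * D o0 o1); pose b := - (D o1 o0 * y).
pose k := ((elem o0 o1 a)^-1 * m * (elem o1 o0 b)^-1)%g.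
have Hk : torus k.
  split.
  - by do ?apply: subgroupM => //; apply: subgroupV => //; exact: A_elem.
  - move=> i i0 i1; apply: subgroupM; [exact: fixes_subgroup| |exact/fixesV/fixes_elem].
    apply: subgroupM; [exact: fixes_subgroup|exact/fixesV/fixes_elem|exact: fm].
  - have mD : GLn_mx m o1 o0 * D o0 o0 = - (GLn_mx m o1 o1 * D o1 o0).
      have /matrixP/(_ o1 o0) := GLn_mxMV m; rewrite -DE.
      rewrite !mxE (bigD1 o0) // (bigD1 o1) //= big1 ?addr0 => [|i /andP[i0 i1]].
        by rewrite (negbTE o10) mulr0n => /eqP; rewrite addr_eq0 => /eqP.
      by rewrite DE (fixes_row _ (fixesV (fm _ i0 i1))) eq_sym (negbTE i0) mulr0.
    rewrite /k !elemV // !GLn_mxM -mulmxA.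
    have -> : forall B : 'M[R]_n, (GLn_mx (elem o0 o1 (- a)) *m B) o1 o0 = B o1 o0.
      move=> B; rewrite -[LHS]mul1r -mulmx_rowv mulmxA elem_mul_row //.
      by rewrite rowvE (negbTE o01) mul0r rowv0 addr0 mulmx_rowv mul1r.
    have -> : (GLn_mx m *m GLn_mx (elem o1 o0 (- b))) o1 o0
        = GLn_mx m o1 o0 - GLn_mx m o1 o1 * b.
      rewrite -[LHS]mul1r -mulmx_rowv mulmxA elem_mul_row //.
      by rewrite mxE !mulmx_rowv rowvE eqxx !mul1r mulrN.
    have -> : GLn_mx m o1 o0 - GLn_mx m o1 o1 * b
      = - (GLn_mx m o1 o0 * (D o0 o0 * y - 1)).
      rewrite mulrBr mulrA mD /b; nc_ring.
    by apply: ideal_opp => //; exact: ideal_mull.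
  - rewrite /k !invgM !invgK !GLn_mxM mulmxA.
    rewrite -[X in I X]mul1r -mulmx_rowv !mulmxA (elem_mul_row b) //.
    rewrite rowvE (negbTE o10) mul0r rowv0 addr0 elem_mul_row //.
    rewrite mxE !mulmx_rowv rowvE eqxx !mul1r -DE /a.
    have -> : D o0 o1 + D o0 o0 * - (y * D o0 o1) = - ((D o0 o0 * y - 1) * D o0 o1) by nc_ring.
    by apply: ideal_opp => //; exact: ideal_mulr.
have kE : k = ((elem o0 o1 a)^-1 * m * (elem o1 o0 b)^-1)%g by [].
clearbody k a b.
have [Ak fk k10 _] := Hk.
have scale_v2 i r : transvection (colv i r) v2 = transvection (colv i 1) (r *: v2).
  apply: eq_transvection; apply/matrixP => x z; rewrite !mulmx_col_row !colvE [in RHS]mxE.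
  by case: eqP; rewrite ?mul1r ?mul0r.
have b_v2 : (elem o1 o0 b * transvection e0' v2)%g =
    (transvection e0' v2 * transvection (colv o1 b) v2 * elem o1 o0 b)%g.
  rewrite transvectionMl ?row_mul_colv0 //.
  have -> : transvection (e0' + colv o1 b) v2 =
      (elem o1 o0 b * transvection e0' v2 * (elem o1 o0 b)^-1)%g.
    rewrite transvectionJ ?row_mul_colv0 // elemV // elem_mul_col // elem_mul_row //.
    by rewrite v21 mul0r rowv0 addr0 colvE eqxx mulr1.
  by group_simp.
pose nu := transvection (colv o1 (GLn_mx k o1 o0)) v2.
have Nnu : N nu.
  rewrite /nu scale_v2; apply: row_in_N; first by rewrite mxE v21 mulr0.
  by move=> x z; rewrite mxE; exact: ideal_mulr.
have k_v2 : (k * transvection e0' v2)%g =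
    (transvection (colv o0 (GLn_mx k o0 o0)) v2 * nu * k)%g.
  rewrite transvectionMl ?row_mul_colv0 //.
  have -> : colv o0 (GLn_mx k o0 o0) + colv o1 (GLn_mx k o1 o0) = GLn_mx k *m e0'.
    apply/matrixP => x z; rewrite !ord1 mulmx_colv mulr1 mxE !colvE.
    have [->|x0] := eqVneq x o0; first by rewrite (negbTE o01) addr0.
    have [->|x1] := eqVneq x o1; first by rewrite add0r.
    by rewrite (fixes_row _ (fk _ x0 x1)) eq_sym (negbTE x0) addr0.
  have {2}<- : v2 *m GLn_mx k^-1%g = v2.
    apply/matrixP => x z; rewrite !ord1 mxE (bigD1 z) //= big1 => [|i iz].
      have [->|z0] := eqVneq z o0; first by rewrite v20 mul0r addr0.
      have [->|z1] := eqVneq z o1; first by rewrite v21 mul0r addr0.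
      by rewrite (fixes_col _ (fixesV (fk _ z0 z1))) eqxx mulr1 addr0.
    have [->|i0] := eqVneq i o0; first by rewrite v20 mul0r.
    have [->|i1] := eqVneq i o1; first by rewrite v21 mul0r.
    by rewrite (fixes_row _ (fixesV (fk _ i0 i1))) eq_sym (negbTE iz) mulr0.
  by rewrite -transvectionJ ?row_mul_colv0 //; group_simp.
have Pb_v2 : P (transvection (colv o1 b) v2 ^ h)%g.
  rewrite scale_v2; apply: (row_transvection_in (P_conj_subgroup h)) => [|j jo1].
    by rewrite mxE v21 mulr0.
  have [->|j0] := eqVneq j o0.
    by rewrite mxE v20 mulr0 elem0 /= conj1g; exact: subgroup1.
  by apply: P_torus_near; rewrite // eq_sym.
(* The conjugate of [elem o1 o0 b] is not handled directly, since its first row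
   is trivial only modulo [I]; a third coordinate writes it as a commutator. *)
have Pb : P (elem o1 o0 b ^ h)%g.
  rewrite -[b]mulr1 -(commg_elem _ _ o12 o20 o10) conjRg; apply: subgroupR => //.
    exact: P_torus_near.
  apply: P_torus_far => //; first exact: A_elem.
  - exact: rowv_colv0.
  - by rewrite colvE (negbTE o02).
  - by rewrite colvE (negbTE o12).
have -> : (elem o0 o1 s * elem o1 o0 t * (elem o0 o1 v1 * transvection e0' v2) * h * p)%g
  = (elem o1 o0 (- tau) * (elem o0 o1 a * k * (elem o1 o0 b * transvection e0' v2) * h * p))%g.
  by rewrite -elemV // kE mE; group_simp.
apply: Y_lower; first by rewrite colvE (negbTE o01).
exists 0, (rowv o1 a + GLn_mx k o0 o0 *: v2), (k * h)%g,
  (nu ^ (k * h) * (transvection (colv o1 b) v2 ^ h * (elem o1 o0 b ^ h * p)))%g; split.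
- by rewrite mxE.
- by rewrite mxE rowvE (negbTE o01) add0r mxE v20 mulr0.
- exact: torusM.
- apply: subgroupM => //; last by apply: subgroupM => //; exact: subgroupM.
  by apply: P_N; apply: N_normal => //; apply: subgroupM => //; case: Hh.
rewrite transvection0l -transvectionMr ?rowv_colv0 //; last first.
  by apply: row_mul_colv0; rewrite mxE v20 mulr0.
rewrite -elem_row -scale_v2 b_v2.
have -> : (elem o0 o1 a * k * (transvection e0' v2 * transvection (colv o1 b) v2 *
   elem o1 o0 b) * h * p)%g = (elem o0 o1 a * (k * transvection e0' v2) *
   transvection (colv o1 b) v2 * elem o1 o0 b * h * p)%g by rewrite !mulgA.
by rewrite k_v2; group_simp.
Qed.

(** The entry [o1] of the column [c] is split off, and [elem o0 o1 s] is moved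
    past the rest of [c] at the cost of the factor [l], which normalizes the
    other factors. *)
Let Y_step s g : Y g -> Y (elem o0 o1 s * g)%g.
Proof.
move=> [c [v [h [p [c0 v0 Hh Pp ->]]]]].
pose t := c o1 0; pose c2 := c - colv o1 t.
have c20 : c2 o0 0 = 0 by rewrite mxE c0 mxE colvE (negbTE o01) subr0.
have c21 : c2 o1 0 = 0 by rewrite mxE [X in _ + X]mxE colvE eqxx subrr.
have -> : transvection c e0 = (transvection c2 e0 * elem o1 o0 t)%g.
  by rewrite transvectionMl ?rowv_colv0 ?subrK // rowv_mul_col0.
clearbody c2 t.
have rc2 : rowv o1 (- s) *m c2 = 0 by exact: rowv_mul_col0.
have [l ldef] : exists l, l = transvection c2 (rowv o1 (- s)) by eexists.
have lE : (elem o0 o1 s * transvection c2 e0)%g =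
    (transvection c2 e0 * l * elem o0 o1 s)%g.
  rewrite ldef transvectionMr ?rowv_mul_col0 //.
  have -> : transvection c2 (e0 + rowv o1 (- s)) =
     (elem o0 o1 s * transvection c2 e0 * (elem o0 o1 s)^-1)%g.
    rewrite transvectionJ ?rowv_mul_col0 // elemV // elem_mul_col // elem_mul_row //.
    by rewrite c21 mulr0 colv0 addr0 rowvE eqxx mul1r.
  by group_simp.
have Al : A l.
  have -> : l = ((transvection c2 e0)^-1 * (elem o0 o1 s * transvection c2 e0)
     * (elem o0 o1 s)^-1)%g by rewrite lE; group_simp.
  have Ac2 := lower_A c20.
  have Ae := A_elem s o01.
  exact: (subgroupM sA (subgroupM sA (subgroupV sA Ac2) (subgroupM sA Ae Ac2))
    (subgroupV sA Ae)).
have fl : fixes o0 l.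
  rewrite ldef; split; rewrite transvectionE //.
    by rewrite mulmxDl mul1mx -mulmxA rowv_colv0 // mulmx0 addr0.
  by rewrite mulmxDr mulmx1 mulmxA rowv_mul_col0 // mul0mx addr0.
have -> : (elem o0 o1 s * (transvection c2 e0 * elem o1 o0 t * transvection e0' v * h * p))%g
  = (transvection c2 e0 * (l * (elem o0 o1 s * elem o1 o0 t * transvection e0' v * h * p)))%g.
  by rewrite !mulgA lE.
apply: Y_lower => //; apply: Y_fixes => //; last exact: Y_upper_lower.
by move=> h' Hh'; rewrite ldef; apply: P_torus_far => //; rewrite -ldef.
Qed.

(** The set of products is stable under left multiplication by the elementary
    matrices: those in column [o0] are absorbed by the lower factor, those
    outside row [o0] normalize the first two factors and are absorbed by the
    parabolic one, and [elem o0 o1 s] gives the rest of row [o0] by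
    commutators. *)
Lemma elementary_gauss : A `<=` gauss.
Proof.
pose B := [set g | A g /\ forall x, Y x -> Y (g * x)%g /\ Y (g^-1 * x)%g].
suff AB : A `<=` B.
  move=> g /AB[_ /(_ 1%g)[]]; last by rewrite mulg1.
  exists 0, 0, 1%g, 1%g; rewrite !mxE transvection0l; split=> //.
  - split=> [|k _ _||]; first exact: subgroup1.
    + by apply: subgroup1; exact: fixes_subgroup.
    + by rewrite mxE (negbTE o10) mulr0n; exact: ideal_zero.
    + by rewrite invg1 mxE (negbTE o01) mulr0n; exact: ideal_zero.
  - exact: subgroup1.
  - by rewrite !mulg1 mul1g transvection0r.
have sB : is_subgroup B.
  apply: is_subgroupI => [|x y [Ax Yx] [Ay Yy]|x [Ax Yx]].
  - by split=> [|x Yx]; [exact: subgroup1|rewrite invg1 mul1g].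
  - split=> [|z Yz]; first exact: subgroupM.
    split; first by rewrite -mulgA; apply: (Yx _ (Yy _ Yz).1).1.
    by rewrite invgM -mulgA; apply: (Yy _ (Yx _ Yz).2).2.
  - split=> [|z Yz]; first exact: subgroupV.
    by rewrite invgK; split; [apply: (Yx _ Yz).2|apply: (Yx _ Yz).1].
have B_elem i j : i != j -> (forall r g, Y g -> Y (elem i j r * g)%g) ->
    forall r, B (elem i j r).
  move=> ij Yij r; split=> [|x Yx]; first exact: A_elem.
  by split; rewrite ?elemV //; exact: Yij.
have B01 r : B (elem o0 o1 r) by apply: B_elem => //; exact: Y_step.
have B1 j r : j != o0 -> j != o1 -> B (elem o1 j r).
  move=> j0 j1; apply: B_elem => [|s g]; first by rewrite eq_sym.
  apply: Y_fixes.
  - by apply: A_elem; rewrite eq_sym.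
  - by apply: fixes_elem; rewrite // eq_sym.
  - by move=> h Hh; exact: P_torus_near.
apply: A_sub => // i j r ij.
have [j0|j0] := eqVneq j o0.
  rewrite j0 in ij *; apply: B_elem => // s g; apply: Y_lower.
  by rewrite colvE eq_sym (negbTE ij).
have [i0|i0] := eqVneq i o0.
  rewrite i0; have [->|j1] := eqVneq j o1; first exact: B01.
  rewrite -[r]mulr1 -(@commg_elem _ _ o0 o1 j) //; try by rewrite eq_sym.
  by apply: subgroupR => //; exact: B1.
have [i1|i1] := eqVneq i o1; first by rewrite i1; apply: B1; rewrite // -i1 eq_sym.
apply: B_elem => // s g; apply: Y_fixes.
- exact: A_elem.
- by apply: fixes_elem; rewrite // eq_sym.
move=> h Hh; apply: P_torus_far => //; first exact: A_elem.
- exact: rowv_colv0.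
- by rewrite colvE eq_sym (negbTE i0).
- by rewrite colvE eq_sym (negbTE i1).
Qed.

(** Each factor of the decomposition either is determined modulo [N] by its
    entries modulo [I], or fixes a coordinate, so that [fixes_central] applies;
    the torus fixes the third coordinate [o2]. *)
Lemma finite_index_central : finite_mod Z A.
Proof.
have mul_sub (S T : set (GLn R n)) : S `<=` A -> T `<=` A ->
    [set (x * y)%g | x in S & y in T] `<=` A.
  by move=> SA TA _ [x /SA Ax [y /TA Ay <-]]; exact: subgroupM.
have mul_fin := finite_mod_mul sA sZ ZA Z_normal.
have lowA : lower `<=` A by move=> _ [c c0 <-]; exact: lower_A.
have uppA : upper `<=` A by move=> _ [v v0 <-]; exact: upper_A.
have torA : torus `<=` A by move=> h [].
have finT : finite_mod Z torus.
  by apply: finite_mod_sub (finite_fixes o2) => h [Ah fh _ _]; split=> //; exact: fh.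
have finP : finite_mod Z P.
  have fixA : [set g | A g /\ fixes o0 g] `<=` A by move=> g [].
  have finN : finite_mod Z N.
    by exists [:: 1%g] => x Nx; exists 1%g; rewrite ?mem_head // invg1 mul1g; exact: NZ.
  have := mul_fin _ _ (mul_sub _ _ lowA fixA) NA
    (mul_fin _ _ lowA fixA finite_lower (finite_fixes o0)) finN.
  apply: finite_mod_sub => _ [g /parabolic_lower[c [h [c0 Ah fh ->]]] [x Nx <-]].
  exists (transvection c e0 * h)%g; last by exists x.
  by exists (transvection c e0); [exists c|exists h].
have PA : P `<=` A by move=> x; exact: P_A.
have LU := mul_fin _ _ lowA uppA finite_lower finite_upper.
have LUT := mul_fin _ _ (mul_sub _ _ lowA uppA) torA LU finT.
have := mul_fin _ _ (mul_sub _ _ (mul_sub _ _ lowA uppA) torA) PA LUT finP.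
apply: finite_mod_sub => g /elementary_gauss[c [v [h [p [c0 v0 Hh Pp ->]]]]].
exists (transvection c e0 * transvection e0' v * h)%g; last by exists p.
exists (transvection c e0 * transvection e0' v)%g; last by exists h.
by exists (transvection c e0); [exists c|exists (transvection e0' v) => //; exists v].
Qed.

(** The conjugacy classes of the generators are finite modulo [N], because [Z]
    has finite index, so that Dietzmann's lemma applies. *)
Theorem elementary_finite_mod (q : nat) : (0 < q)%N -> (forall r, I (r *+ q)) ->
  finite_mod N A.
Proof.
move=> q_gt0 Iq; have [F [p pP]] := ideal_class idI finI.
have [s sP] := finite_index_central.
pose rep (a : F) := xget 0 [set r | p r = a].
have repP r : I (- rep (p r) + r).
  rewrite addrC; apply/pP; rewrite /rep; case: xgetP => [_ _ ->//|/(_ r)/=]; by case.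
pose offdiag := [seq ij : 'I_n * 'I_n <- enum {: 'I_n * 'I_n} | ij.1 != ij.2].
pose X := [seq (elem ia.1.1 ia.1.2 (rep ia.2) ^ y)%g |
  ia <- [seq (ij, z) | ij <- offdiag, z <- enum F], y <- [seq y <- s | `[< A y >]]].
have inX i j z y : i != j -> y \in s -> A y -> (elem i j (rep z) ^ y)%g \in X.
  move=> ij ys Ay; apply: (@allpairs_f _ _ _
     (fun (ia : 'I_n * 'I_n * F) y => (elem ia.1.1 ia.1.2 (rep ia.2) ^ y)%g) _ _ (i, j, z)).
    by apply: allpairs_f; rewrite ?mem_enum // mem_filter ij mem_enum.
  by rewrite mem_filter ys andbT; apply/asboolP.
have XP (w : GLn R n) : w \in X -> exists i j z y, [/\ i != j, A y & w = (elem i j (rep z) ^ y)%g].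
  move=> /allpairsP[[[[i j] z] y] /= [/allpairsP[[[i' j'] z'] /= [+ _ [-> -> ->]]] + ->]].
  rewrite !mem_filter => /andP[/= ij _] /andP[/asboolP Ay _].
  by exists i', j', z', y.
have N_commute x y : A x -> Z y -> N (x^-1 * x ^ y)%g.
  move=> Ax [Ay Zy]; rewrite -commgEl -invgR; apply: subgroupV => //; exact: Zy.
apply: (@Dietzmann _ A N sA sN N_normal X q _ q_gt0 _ _ _ defA).
- move=> w /XP[i [j [z [y [ij Ay ->]]]]]; apply: subgroupJ => //; exact: A_elem.
- move=> w /XP[i [j [z [y [ij Ay ->]]]]]; rewrite -conjXg elemX //.
  by apply: N_normal => //; exact: N_elem.
- move=> w g /XP[i [j [z [y [ij Ay ->]]]]] Ag.
  have Ayg : A (y * g)%g by exact: subgroupM.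
  have [y' y's Zy'] := sP _ Ayg.
  have Ay' : A y'.
    have -> : y' = ((y * g) / (y'^-1 * (y * g)))%g by group_simp.
    by apply: subgroupF => //; exact: ZA.
  exists (elem i j (rep z) ^ y')%g; first exact: inX.
  have -> : ((elem i j (rep z) ^ y) ^ g)%g =
      ((elem i j (rep z) ^ y') ^ (y'^-1 * (y * g)))%g by rewrite -!conjgM mulVKg.
  by apply: N_commute => //; apply: subgroupJ => //; exact: A_elem.
move=> g [i [j [r [ij eg]]]].
have -> : g = elem i j r by apply: GLn_mx_inj; rewrite eg elemE.
have [y ys] := sP _ (subgroup1 sA); rewrite mulg1 => /(subgroupV sZ); rewrite invgK => Zy.
exists (elem i j (rep (p r)) ^ y)%g; first by apply: inX => //; exact: ZA.
apply: (@cong_trans _ N sN _ (elem i j (rep (p r)))).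
  by apply: cong_sym => //; apply: N_commute => //; exact: A_elem.
by rewrite elemV // elemD //; exact: N_elem.
Qed.

End Decomposition.

(** * Homomorphisms from subgroups of finite index *)

(** The images of the elementary matrices inherit the Heisenberg relations, and
    all that is needed of the target group is that these force torsion. *)
Definition heisenberg_torsion (G : groupType) := forall x y : G,
  commute [~ x, y]%g x -> commute [~ x, y]%g y -> torsion [~ x, y]%g.

Lemma common_multiple (T : eqType) (P : T -> nat -> Prop) (s : seq T) :
  (forall x q k, P x q -> P x (q * k)%N) ->
  (forall x, exists2 q, (0 < q)%N & P x q) ->
  exists2 q, (0 < q)%N & forall x, x \in s -> P x q.
Proof.
move=> PM exP; elim: s => [|x s [q q0 Pq]]; first by exists 1%N.
have [q' q'0 Pq'] := exP x; exists (q' * q)%N; first by rewrite muln_gt0 q'0.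
move=> y; rewrite inE => /predU1P[->|/Pq]; first exact: PM.
by rewrite mulnC; exact: PM.
Qed.

Section FiniteImage.
Variables (R : nzRingType) (n : nat).
Hypothesis n_ge3 : (3 <= n)%N.
Let A := elementary_group R n.
Variables (E : set (GLn R n)) (G : groupType) (f : GLn R n -> G).
Hypotheses (sE : is_subgroup E) (EA : E `<=` elementary_group R n).
Hypothesis E_index : finite_index (elementary_group R n) E.
Hypothesis fM : {in E &, {morph f : x y / (x * y)%g}}.
Hypothesis G_torsion : heisenberg_torsion G.
Local Open Scope group_scope.

Let sA : is_subgroup A := @elementary_subgroup R n.

Let fmul x y : E x -> E y -> f (x * y) = f x * f y.
Proof. by move=> Ex Ey; apply: fM; apply/mem_set. Qed.

Let f1 : f 1 = 1.
Proof.
apply: (@mulgI _ (f 1)); rewrite mulg1 -fmul ?mulg1 //; exact: subgroup1.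
Qed.

Let finv x : E x -> f x^-1 = (f x)^-1.
Proof.
move=> Ex; apply: (@mulgI _ (f x)).
by rewrite mulgV -fmul ?mulgV //; exact: subgroupV.
Qed.

Let fexp x m : E x -> f (x ^+ m) = f x ^+ m.
Proof.
move=> Ex; elim: m => [|m IHm]; first by rewrite !expg0 f1.
by rewrite !expgS fmul ?IHm //; exact: subgroupX.
Qed.

Let fcomm x y : E x -> E y -> f [~ x, y] = [~ f x, f y].
Proof.
move=> Ex Ey; have Ex' := subgroupV sE Ex; have Ey' := subgroupV sE Ey.
rewrite !commgEl !conjgE !fmul ?finv //; do ?exact: subgroupM.
by apply: subgroupM => //; exact: subgroupM.
Qed.

Let ker := [set x | E x /\ f x = 1].

Let ker_subgroup : is_subgroup ker.
Proof.
apply: is_subgroupI => [|x y [Ex fx] [Ey fy]|x [Ex fx]].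
- by split; [exact: subgroup1|exact: f1].
- by split; [exact: subgroupM|rewrite fmul // fx fy mulg1].
- by split; [exact: subgroupV|rewrite finv // fx invg1].
Qed.

Let ker_normal x g : ker x -> E g -> ker (x ^ g).
Proof.
move=> [Ex fx] Eg; split; first exact: subgroupJ.
have Eg' := subgroupV sE Eg.
rewrite conjgE !fmul ?finv // ?fx ?mul1g ?mulVg //; exact: subgroupM.
Qed.

Let finite_cosets : finite_mod E A.
Proof.
have [F [p pP]] := finite_image_invariant E_index.
apply: (finite_mod_invariant (p := fun x => p [set x * h | h in E])).
move=> g h Ag Ah /pP e; have : [set g * x | x in E] h.
  by rewrite e //; exists 1; [exact: subgroup1|rewrite mulg1].
by case=> x Ex <-; rewrite mulKg.
Qed.

Let exponent : exists2 e, (0 < e)%N & forall g, A g -> E (g ^+ e).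
Proof.
have [m repeat] := finite_mod_repeat sE finite_cosets.
exists m`!; first exact: fact_gt0.
move=> g Ag; have [i [j [/andP[lt_ij le_jm]]]] := repeat _ (fun i => subgroupX i sA Ag).
have -> : (g ^+ i)^-1 * g ^+ j = g ^+ (j - i).
  by rewrite -{1}(subnKC (ltnW lt_ij)) expgnDr mulKg.
have /dvdnP[c ->] : (j - i %| m`!)%N by apply: dvdn_fact; lia.
by rewrite mulnC expgnA; exact: subgroupX.
Qed.

Let third (i j : 'I_n) : exists2 k, k != i & k != j.
Proof.
apply: contrapT => no.
have /subset_leq_card : [set: 'I_n]%SET \subset [set i; j]%SET.
  apply/fintype.subsetP => k _; rewrite !inE; apply: contrapT => /negP.
  by rewrite negb_or => /andP[ki kj]; apply: no; exists k.
by rewrite cardsT card_ord cards2; move: n_ge3; case: (i != j); lia.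
Qed.

(** The conjugate by [g] is what makes the kernel contain a normal subgroup of
    the whole elementary group.  Torsion gives one integral [r] with
    [elem i k r] in the kernel, and the commutators with [elem k j] spread it to
    a whole root subgroup of [q R]. *)
Let kernel_elem g i j : A g -> i != j ->
  exists2 q, (0 < q)%N & forall r : R, ker (elem i j (r *+ q)%R ^ g).
Proof.
move=> Ag ij; have [k ki kj] := third i j; have [e e0 Ee] := exponent.
have ik : i != k by rewrite eq_sym.
have jk : j != k by rewrite eq_sym.
have E_elem a b r : a != b -> E (elem a b (r *+ e)%R ^ g).
  move=> ab; rewrite -elemX // conjXg; apply: Ee.
  by apply: (subgroupJ sA) => //; exact: elem_in.
pose x := elem i j (1 *+ e)%R ^ g; pose y := elem j k (1 *+ e)%R ^ g.
have Ex : E x by exact: E_elem.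
have Ey : E y by exact: E_elem.
have xyE : [~ x, y] = elem i k (1 *+ e * (1 *+ e))%R ^ g by rewrite -conjRg commg_elem.
have Exy : E [~ x, y] by exact: subgroupR.
have fcommute z : E z -> commute [~ x, y] z -> commute [~ f x, f y] (f z).
  by move=> Ez xyz; rewrite -fcomm // /commute -!fmul // xyz.
have conj_commute z t : commute z t -> commute (z ^ g) (t ^ g).
  by rewrite /commute -!conjMg => ->.
have cx : commute [~ x, y] x.
  by rewrite xyE; apply: conj_commute; exact: commute_elem_row.
have cy : commute [~ x, y] y.
  by rewrite xyE; apply: conj_commute; exact: commute_elem_col.
have [t t0] := G_torsion (fcommute _ Ex cx) (fcommute _ Ey cy).
rewrite -fcomm // -fexp // => ft.
exists (e * e * t * e)%N; first by rewrite !muln_gt0 e0 t0.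
move=> r.
have -> : (r *+ (e * e * t * e) = (1 *+ e * (1 *+ e)) *+ t * (r *+ e))%R.
  rewrite mulrnAl -mulrA !mulr_natl -!mulrnA; congr (_ *+ _)%R.
  by rewrite mulnAC !mulnA.
rewrite -(commg_elem _ _ ik kj ij) conjRg.
have Kxy : ker (elem i k ((1 *+ e * (1 *+ e)) *+ t)%R ^ g).
  by rewrite -elemX // conjXg -xyE; split=> //; exact: subgroupX.
rewrite commgEl; apply: subgroupM => //; first exact: subgroupV.
by apply: ker_normal => //; exact: E_elem.
Qed.

(** The kernel of [f] contains the normal core [N], and [N] contains the
    elementary matrices over some ideal [q R]; this ideal is nonzero because the
    characteristic is zero, so it has finite index. *)
Theorem heisenberg_torsion_finite_image : char_zero R ->
  (forall I : set R, two_sided_ideal I -> I <> [set 0%R] -> ideal_finite_index I) ->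
  finite_set (f @` E).
Proof.
move=> R0 R_ideals.
pose N := [set g | A g /\ forall h, A h -> ker (g ^ h)].
have NA : N `<=` A by move=> g [].
have sN : is_subgroup N.
  apply: is_subgroupI => [|x y [Ax Kx] [Ay Ky]|x [Ax Kx]].
  - by split=> [|h _]; [exact: (subgroup1 sA)|rewrite conj1g; exact: subgroup1].
  - split=> [|h Ah]; first exact: (subgroupM sA).
    by rewrite conjMg; apply: subgroupM => //; [exact: Kx|exact: Ky].
  - split=> [|h Ah]; first exact: (subgroupV sA).
    by rewrite conjVg; apply: subgroupV => //; exact: Kx.
have N_normal x g : N x -> A g -> N (x ^ g).
  move=> [Ax Kx] Ag; split=> [|h Ah]; first exact: (subgroupJ sA).
  by rewrite -conjgM; apply: Kx; exact: (subgroupM sA).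
have [s sP] := finite_cosets.
have [q q0 qP] : exists2 q, (0 < q)%N & forall i j r, i != j -> N (elem i j (r *+ q)%R).
  pose Q (t : GLn R n * 'I_n * 'I_n) (q : nat) := A t.1.1 -> t.1.2 != t.2 ->
    forall r : R, ker (elem t.1.2 t.2 (r *+ q)%R ^ t.1.1).
  have [||q q0 qP] := @common_multiple _ Q
      [seq (gi, j) | gi <- [seq (g, i) | g <- s, i <- enum 'I_n], j <- enum 'I_n].
  - by move=> [[g i] j] q k Qq Ag ij r; rewrite mulnC mulrnA; exact: Qq.
  - move=> [[g i] j]; have [Ag|nAg] := pselect (A g); last by exists 1%N.
    have [ij|ij] := boolP (i != j); last by exists 1%N => // _; rewrite (negbTE ij).
    by have [q q0 Kq] := kernel_elem Ag ij; exists q.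
  exists q => // i j r ij; split=> [|h Ah]; first exact: elem_in.
  have [y ys Ey] := sP _ Ah.
  have -> : h = y * (y^-1 * h) by rewrite mulVKg.
  rewrite conjgM; apply: ker_normal => //.
  apply: (qP (y, i, j)) => //; last first.
    have -> : y = h / (y^-1 * h) by group_simp.
    by apply: (subgroupF sA) => //; exact: EA.
  by apply/allpairsP; exists ((y, i), j); rewrite allpairs_f ?mem_enum.
pose I := [set (r *+ q)%R | r in [set: R]].
have idI : two_sided_ideal I.
  split; first split.
  - by apply/mem_set; exists 0%R; rewrite ?mul0rn.
  - move=> _ _ /set_mem[r _ <-] /set_mem[t _ <-]; apply/mem_set.
    by exists (r - t)%R => //; rewrite mulrnBl.
  - move=> a _ [r _ <-]; split; first by exists (a * r)%R => //; rewrite mulrnAr.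
    by exists (r * a)%R => //; rewrite mulrnAl.
have finI : ideal_finite_index I.
  apply: R_ideals => // I0; have := R0 _ q0.
  have : I (1 *+ q)%R by exists 1%R.
  by rewrite I0 => /= ->; rewrite eqxx.
pose o (k : nat) (lt_k : (k < 3)%N) := Ordinal (leq_trans lt_k n_ge3).
have finN : finite_mod N A.
  apply: (@elementary_finite_mod R n I idI finI N (@o 0%N isT) (@o 1%N isT) (@o 2%N isT)
    _ _ _ A erefl sN NA N_normal _ q q0) => //.
  - by move=> i j _ ij [r _ <-]; exact: qP.
  - by move=> r; exists r.
have [s' sP'] := finN.
pose c y := xget 1 [set g | E g /\ N (y^-1 * g)].
apply: (@sub_finite_set _ _ [set` [seq f (c y) | y <- s']]); last exact: finite_seq.
move=> _ [g Eg <-] /=; have [y ys Ng] := sP' _ (EA Eg).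
suff -> : f g = f (c y) by exact: map_f.
rewrite /c; case: xgetP => [h _ [Eh Nh]|/(_ g)[]//].
have [_ /(_ 1 (subgroup1 sA))[]] : N (g^-1 * h).
  have -> : g^-1 * h = (y^-1 * g)^-1 * (y^-1 * h) by group_simp.
  by apply: subgroupM => //; exact: subgroupV.
rewrite conjg1 => _; rewrite fmul ?finv //; last exact: subgroupV.
by move=> /mulg1_eq <-; rewrite invgK.
Qed.

End FiniteImage.

(** * Torsion of distorted elements in groups of isometries *)

Lemma torsion_of_finite_powers (G : groupType) (g : G) (S : set G) :
  finite_set S -> (forall m, S (g ^+ m)%g) -> torsion g.
Proof.
move=> /finite_seqP[s ->] /= gs.
have lt_i m : (index (g ^+ m)%g s < size s)%N by rewrite index_mem; exact: gs.
have /injectivePn[i [j ij]] :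
    ~~ injectiveb (fun i : 'I_(size s).+1 => Ordinal (lt_i i)).
  by apply/negP => /injectiveP /leq_card; rewrite !card_ord ltnn.
move=> /(congr1 val) /= eij.
have {}eij : (g ^+ i = g ^+ j)%g.
  by rewrite -(nth_index g (gs i)) eij nth_index //; exact: gs.
wlog lt_ij : i j ij eij / (i < j)%N.
  move=> W; case: (ltngtP i j) => [|ji|/val_inj e]; first exact: W.
    by apply: (W j i) => //; rewrite eq_sym.
  by rewrite e eqxx in ij.
exists (j - i)%N; first by rewrite subn_gt0.
by apply: (@mulgI _ (g ^+ i)%g); rewrite -expgnDr subnKC ?mulg1 // ltnW.
Qed.

Lemma torsionJ (G : groupType) (g h : G) : torsion (g ^ h)%g -> torsion g.
Proof.
move=> [k k0]; rewrite -conjXg => /eqP; rewrite conjg_eq1 => /eqP gk.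
by exists k.
Qed.

Lemma bounded_multiples (K : realType) (D C : K) :
  (forall m : nat, m%:R * D <= C) -> D <= 0.
Proof.
move=> mD; rewrite leNgt; apply/negP => D0.
have C0 : 0 <= C / D by rewrite divr_ge0 ?(ltW D0) //; have := mD 0%N; rewrite mul0r.
have := archi_boundP C0; rewrite ltr_pdivrMr // => lt_C.
by move: lt_C; rewrite ltNge mD.
Qed.

Section Isometries.
Variables (K : realType) (G : groupType) (X : metricType K) (act : G -> X -> X).
Hypothesis act_isom : isometric_action act.
Implicit Types (g h x y z : G) (p q : X).

Let disp g p := mdist p (act g p).

Lemma act1 p : act 1%g p = p. Proof. by case: act_isom. Qed.
Lemma actM g h p : act (g * h)%g p = act g (act h p). Proof. by case: act_isom. Qed.
Lemma act_mdist g p q : mdist (act g p) (act g q) = mdist p q.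
Proof. by case: act_isom. Qed.

Lemma actX g p m : act g p = p -> act (g ^+ m)%g p = p.
Proof.
by move=> gp; elim: m => [|m IHm]; rewrite ?expg0 ?act1 // expgS actM IHm.
Qed.

Lemma dispM g h p : disp (g * h)%g p <= disp g p + disp h p.
Proof.
rewrite /disp actM -(act_mdist g p (act h p)); exact: metric_triangle.
Qed.

Lemma dispV g p : disp g^-1%g p = disp g p.
Proof. by rewrite /disp -(act_mdist g) -actM mulgV act1 metric_sym. Qed.

Lemma dispX g p m : disp (g ^+ m)%g p <= m%:R * disp g p.
Proof.
elim: m => [|m IHm]; first by rewrite expg0 /disp act1 mdistxx mul0r.
by rewrite expgS (le_trans (dispM _ _ _)) // -addn1 natrD mulrDl mul1r addrC lerD2r.
Qed.

Lemma disp_conj g h p : disp (g ^ h)%g p = disp g (act h p).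
Proof. by rewrite /disp conjgE !actM -(act_mdist h) -actM mulgV act1. Qed.

Lemma disp_comm x y p : commute [~ x, y]%g x -> commute [~ x, y]%g y ->
  forall m : nat, disp ([~ x, y] ^+ (m * m))%g p
    <= m%:R * (2 * (disp x p + disp y p)).
Proof.
move=> zx zy m; rewrite -commXX //; have Xx := dispX x p m; have Xy := dispX y p m.
rewrite commgEl conjgE (le_trans (dispM _ _ _)) // dispV.
have := dispM (y ^+ m)^-1%g (x ^+ m * y ^+ m)%g p; rewrite dispV => d1.
have := dispM (x ^+ m)%g (y ^+ m)%g p => d2.
lra.
Qed.

Lemma fixed_point_torsion g p : cat0_proper act -> act g p = p -> torsion g.
Proof.
move=> /(_ p)[r r0 finB] gp; apply: torsion_of_finite_powers finB _ => m /=.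
by exists p; split; [exists p; rewrite ?actX //|]; rewrite ballEmdist /= mdistxx.
Qed.

(** ** Actions on hyperbolic spaces *)

(** A quasi-isometric embedding of the powers contradicts the displacement
    [O(m)] of the power [m ^ 2]; if the orbits are bounded, properness leaves
    finitely many powers. *)
Lemma hyperbolic_torsion x y : [set: X] !=set0 -> hyp_proper act ->
  hyp_semisimple act [~ x, y]%g ->
  commute [~ x, y]%g x -> commute [~ x, y]%g y -> torsion [~ x, y]%g.
Proof.
move=> [p _] prop ss zx zy; set z := [~ x, y]%g in ss *.
case: ss => [/(_ p)[M bdd]|[x0 [lam [eps [lam1 eps0 qi]]]]].
  apply: (torsion_of_finite_powers (prop p (Num.max M 1) _)).
    by rewrite lt_max ltr01 orbT.
  by move=> m /=; have := bdd 0 m; rewrite /= expg0 act1 le_max => ->.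
exfalso; have lam0 : 0 < lam by exact: lt_le_trans lam1.
suff : lam^-1 <= 0 by rewrite leNgt invr_gt0 lam0.
apply: (@bounded_multiples _ _ (2 * (disp x x0 + disp y x0) + eps)) => m.
case: m => [|m]; first by rewrite mul0r; have := mdist_ge0 x0 (act x x0);
  have := mdist_ge0 x0 (act y x0); rewrite /disp; lra.
have /andP[+ _] := qi 0 (m.+1 * m.+1)%N I I.
rewrite /= expg0 act1 sub0r normrN => le1.
have := le_trans le1 _ => /(_ _ (disp_comm x0 zx zy m.+1)).
rewrite ger0_norm // -pmulrn natrM => le2.
have m0 : 0 < m.+1%:R :> K by rewrite ltr0n.
rewrite -(ler_pM2l m0); have : 1 <= m.+1%:R :> K by rewrite ler1n.
move: (m.+1%:R : K) m0 le2 => M M0 le2 M1.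
have : eps <= M * eps by rewrite ler_peMl.
move: le2; move: (lam^-1) (disp x x0 + disp y x0) => l c; nra.
Qed.

(** ** Actions on CAT(0) spaces *)

(** With [q] the midpoint of [p] and [g p], the midpoint of [g p] and [g^2 p]
    is [g q], and the CAT(0) inequality for the triangle [g p, p, g^2 p] bounds
    [d(q, g q)] by half of [d(p, g^2 p)]. *)
Lemma cat0_double_displacement g (D : K) : cat0_space X ->
  (forall p, D <= disp g p) -> forall p, 2 * D <= disp (g ^+ 2)%g p.
Proof.
move=> [[_ geo] _ cat0] D_le p; rewrite expg2 /disp actM.
have [c [c0 ca c_isom]] := geo p (act g p).
set a := mdist p (act g p) in ca c_isom.
pose l := mdist p (act g (act g p)) / 2.
have a0 : 0 <= a by exact: mdist_ge0.
have l0 : 0 <= l by rewrite divr_ge0 ?mdist_ge0.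
have la : l <= a.
  have := metric_triangle p (act g p) (act g (act g p)).
  by rewrite act_mdist -/a /l; lra.
have [c1 geo1] := geo p (act g (act g p)).
(* The isosceles comparison triangle with apex [(0, h)] and base on the first
   axis; the midpoints of its equal sides are at distance [l]. *)
pose v (i : 'I_3) := match val i with
  | 0%N => act g p | 1%N => p | _ => act g (act g p) end.
pose side (i : 'I_3) (t : K) := match val i with
  | 0%N => c (a - t) | 1%N => c1 t | _ => act g (c (a - t)) end.
pose S i := side i @` `[0, mdist (v i) (v (ordS i))].
pose h := Num.sqrt (a ^+ 2 - l ^+ 2).
have hE : h ^+ 2 = a ^+ 2 - l ^+ 2.
  by rewrite sqr_sqrtr // subr_ge0 ler_sqr ?nnegrE.
pose pt (r s : K) : 'rV[K]_2 := \row_(k < 2) if k == 0 then r else s.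
have dist_pt r s r' s' : eucl_dist (pt r s) (pt r' s') =
    Num.sqrt ((r - r') ^+ 2 + (s - s') ^+ 2).
  by rewrite /eucl_dist !big_ord_recl big_ord0 addr0 !mxE.
pose w (i : 'I_3) := match val i with
  | 0%N => pt 0 h | 1%N => pt (- l) 0 | _ => pt l 0 end.
have rev_isom : {in `[0, a] &, forall s t : K, mdist (c (a - s)) (c (a - t)) = `|s - t|}.
  move=> s t /[!in_itv]/= /andP[s0 sa] /andP[t0 ta]; rewrite c_isom.
  - by rewrite opprB addrC addrA subrK distrC.
  - by rewrite in_itv /= subr_ge0 sa gerBl.
  - by rewrite in_itv /= subr_ge0 ta gerBl.
have tri : geodesic_triangle v S.
  case=> [[|[|[|//]]] lt3] /=; rewrite /geodesic_segment /S /v /side /=.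
  - exists (fun t => c (a - t)) => //; split; first by rewrite subr0.
      by rewrite metric_sym -/a subrr.
    by rewrite metric_sym -/a.
  - by exists c1.
  - exists (fun t => act g (c (a - t))) => //; split; first by rewrite subr0 ca.
      by rewrite act_mdist metric_sym -/a subrr c0.
    by rewrite act_mdist metric_sym -/a => s t sa ta; rewrite act_mdist rev_isom.
have d01 : mdist (act g p) p = a by rewrite metric_sym.
have d02 : mdist (act g p) (act g (act g p)) = a by rewrite act_mdist.
have d12 : mdist p (act g (act g p)) = 2 * l by rewrite /l mulrC divfK.
have comp : comparison_triangle v w.
  have sqrt_eq b d : 0 <= d -> b = d ^+ 2 -> Num.sqrt b = d.
    by move=> d0 ->; rewrite sqrtr_sqr ger0_norm.
  have l20 : 0 <= 2 * l by rewrite mulr_ge0.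
  have d10 : mdist p (act g p) = a by [].
  have d20 : mdist (act g (act g p)) (act g p) = a by rewrite metric_sym.
  have d21 : mdist (act g (act g p)) p = 2 * l by rewrite metric_sym.
  case=> [[|[|[|//]]] lt3] [[|[|[|//]]] lt3']; rewrite /v /w /= dist_pt
    ?mdistxx ?d01 ?d02 ?d12 ?d10 ?d20 ?d21; apply: sqrt_eq => //; by move: hE; lra.
have q'_mid : eucl_segment (pt 0 h) (pt (- l) 0) (pt (- l / 2) (h / 2)).
  exists (1 / 2); first by rewrite /= in_itv /=; apply/andP; split; lra.
  by apply/rowP => k; rewrite !mxE; case: ifP => _; lra.
have q''_mid : eucl_segment (pt l 0) (pt 0 h) (pt (l / 2) (h / 2)).
  exists (1 / 2); first by rewrite /= in_itv /=; apply/andP; split; lra.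
  by apply/rowP => k; rewrite !mxE; case: ifP => _; lra.
have half r s : r ^+ 2 + s ^+ 2 = (a / 2) ^+ 2 -> Num.sqrt (r ^+ 2 + s ^+ 2) = a / 2.
  by move=> ->; rewrite sqrtr_sqr ger0_norm // divr_ge0.
have a2_in : `[0, a]%classic (a / 2).
  by rewrite /= in_itv /=; apply/andP; split; lra.
have c_mid : mdist (act g p) (c (a / 2)) = a / 2.
  rewrite -ca c_isom ?in_itv /=; [|by apply/andP; split; lra..].
  by rewrite ger0_norm; lra.
have gc_mid : mdist (act g (act g p)) (act g (c (a / 2))) = a / 2.
  by rewrite act_mdist.
have aa2 : a - a / 2 = a / 2 by lra.
pose i0 : 'I_3 := Ordinal (isT : (0 < 3)%N); pose i2 : 'I_3 := Ordinal (isT : (2 < 3)%N).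
have le_l : mdist (c (a / 2)) (act g (c (a / 2))) <= l.
  have -> : l = eucl_dist (pt (- l / 2) (h / 2)) (pt (l / 2) (h / 2)).
    rewrite dist_pt subrr expr0n addr0 sqrtr_sqr -mulrBl ler0_norm; last lra.
    lra.
  apply: (cat0 v S w tri comp i0 i2).
  - by exists (a / 2); rewrite /v /side /= ?aa2 // d01.
  - by exists (a / 2); rewrite /v /side /= ?aa2 // metric_sym d02.
  - split=> //; rewrite /v /w /= dist_pt c_mid half //.
    by move: hE; lra.
  - split=> //; rewrite /v /w /= dist_pt gc_mid half //.
    by move: hE; lra.
by have := le_trans (D_le _) le_l; rewrite /l; lra.
Qed.

(** Convexity makes displacements grow linearly along powers, while that of the
    commutator grows like a square root. *)
Lemma cat0_displacement_0 x y (D : K) : cat0_space X ->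
  commute [~ x, y]%g x -> commute [~ x, y]%g y ->
  (forall p, D <= disp [~ x, y]%g p) -> D <= 0.
Proof.
move=> Xcat0 zx zy D_le.
have [[[p0 _] _] _ _] := Xcat0.
have D2 k p : 2 ^+ k * D <= disp ([~ x, y] ^+ (2 ^ k))%g p.
  elim: k p => [|k IHk] p; first by rewrite expr0 mul1r expg1.
  rewrite exprS -mulrA expnSr expgnA; exact: cat0_double_displacement.
apply: (@bounded_multiples _ _ (2 * (disp x p0 + disp y p0))) => m.
have [D0|D0] := leP D 0.
  apply: (@le_trans _ _ 0); first by rewrite mulr_ge0_le0.
  by rewrite mulr_ge0 ?addr_ge0 ?mdist_ge0.
have P0 : 0 < 2 ^+ m :> K by rewrite exprn_gt0.
have := le_trans (D2 (m + m)%N p0) _ => /(_ (2 ^+ m * (2 * (disp x p0 + disp y p0)))).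
rewrite expnD -[X in _ <= X * _ -> _]natrX exprD -mulrA ler_pM2l // => le_D.
apply: le_trans (le_D (disp_comm _ zx zy _)); rewrite ler_pM2r //.
by rewrite -natrX ler_nat ltnW // ltn_expl.
Qed.

Lemma cat0_semisimple_torsion x y : cat0_space X -> cat0_proper act ->
  cat0_semisimple act [~ x, y]%g ->
  commute [~ x, y]%g x -> commute [~ x, y]%g y -> torsion [~ x, y]%g.
Proof.
move=> Xcat0 prop [p p_min] zx zy.
apply: (fixed_point_torsion (p := p)) => //; apply/esym/mdist_positivity/eqP.
rewrite eq_le mdist_ge0 andbT; apply: (cat0_displacement_0 Xcat0 zx zy) => q.
rewrite p_min; apply: ge_inf; last by exists q.
by exists 0 => _ [t _ <-]; exact: mdist_ge0.
Qed.

(** A compact fundamental domain is covered by finitely many balls meeting only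
    finitely many translates, hence isometries of small displacement have a
    conjugate fixing one of the centers. *)
Lemma cat0_cocompact_torsion x y : cat0_space X -> cat0_proper act ->
  cocompact_action act ->
  commute [~ x, y]%g x -> commute [~ x, y]%g y -> torsion [~ x, y]%g.
Proof.
move=> Xcat0 prop [C Ccompact Ccover] zx zy.
pose small (m : nat) (p : X) := forall g, disp g p < m.+1%:R^-1 -> torsion g.
have [m Cm] : exists m, C `<=` small m.
  suff near_C : \forall m \near \oo, C `<=` small m by exact: filter_ex near_C.
  apply: ((compact_near_coveringP C).1 Ccompact nat \oo small) => c _.
  have [r r0 /finite_seqP[s sE]] := prop c.
  have [d [d0 dr dP]] : exists d, [/\ 0 < d, d <= r &
      forall g, g \in s -> act g c <> c -> d <= disp g c].
    elim: s {sE} => [|g s [d [d0 dr dP]]]; first by exists r.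
    have [gc|gc] := pselect (act g c = c).
      by exists d; split=> // h; rewrite inE => /predU1P[->//|/dP].
    have g0 : 0 < disp g c by rewrite mdist_gt0; apply/eqP => e; apply: gc.
    exists (Num.min d (disp g c)); split.
    - by rewrite lt_min d0.
    - by rewrite ge_min dr.
    - by move=> h; rewrite inE ge_min => /predU1P[-> _|/dP H /H ->//]; rewrite lexx orbT.
  have d30 : 0 < d / 3 by rewrite divr_gt0.
  exists (ball c (d / 3), [set m : nat | m.+1%:R^-1 < d / 3]).
    by split; [exact: nbhsx_ballx|exact: (near_infty_natSinv_lt (PosNum d30))].
  move=> [p m] [/= + lt_m] g lt_g; rewrite ballEmdist /= => cp.
  have lt_gp : disp g p < d / 3 by exact: lt_trans lt_m.
  apply: (@fixed_point_torsion _ c) => //; apply: contrapT => gc.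
  have gs : g \in s.
    have : [set g | act g @` ball c r `&` ball c r !=set0] g; last by rewrite sE.
    exists (act g p); rewrite ballEmdist /=; split; first by exists p => //=; lra.
    by have := metric_triangle c p (act g p); rewrite /disp in lt_gp; lra.
  have := dP g gs gc; rewrite /disp in lt_gp *.
  have := metric_triangle c p (act g c); have := metric_triangle p (act g p) (act g c).
  by rewrite act_mdist (metric_sym p c); lra.
have [[p lt_p]|no] := pselect (exists p, disp [~ x, y]%g p < m.+1%:R^-1).
  have : (\bigcup_g (act g @` C)) p by rewrite Ccover.
  case=> g _ [c Cc gc]; apply: (@torsionJ _ _ g); apply: (Cm c Cc).
  by rewrite disp_conj gc.
have : m.+1%:R^-1 <= 0 :> K; last by rewrite leNgt invr_gt0 ltr0n.
apply: (cat0_displacement_0 Xcat0 zx zy) => p; rewrite leNgt; apply/negP => lt_p.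
by apply: no; exists p.
Qed.

End Isometries.

(** * Semi-hyperbolic groups *)

Section LatticeOfRelations.

Lemma closed_scale (L : int -> (nat -> int) -> Prop) :
  L 0 (fun=> 0) ->
  (forall k m k' m', L k m -> L k' m' -> L (k + k') (fun i => m i + m' i)) ->
  (forall k m, L k m -> L (- k) (fun i => - m i)) ->
  forall a k m, L k m -> L (a * k) (fun i => a * m i).
Proof.
move=> L0 LD LN a k m Lkm.
have Lnat (c : nat) : L (c%:Z * k) (fun i => c%:Z * m i).
  elim: c => [|c IHc].
    rewrite mul0r; under eq_fun do rewrite mul0r; exact: L0.
  rewrite -addn1 PoszD mulrDl mul1r; under eq_fun do rewrite mulrDl mul1r.
  exact: LD.
case: a => c; first exact: Lnat.
rewrite NegzE mulNr; under eq_fun do rewrite mulNr.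
exact: LN.
Qed.

(** If the relation lattice [L] of [z] with [r] further elements contains no
    multiple of [z], the coefficient of [z] is bounded linearly by the others:
    a relation in which the last coefficient is [m0 != 0] eliminates it. *)
Lemma relation_bound (r : nat) (L : int -> (nat -> int) -> Prop) :
  L 0 (fun=> 0) ->
  (forall k m k' m', L k m -> L k' m' -> L (k + k') (fun i => m i + m' i)) ->
  (forall k m, L k m -> L (- k) (fun i => - m i)) ->
  (forall k m, L k m -> (forall i, (i < r)%N -> m i = 0) -> k = 0) ->
  exists M : nat, forall k m, L k m -> `|k| <= M%:Z * \sum_(i < r) `|m i|.
Proof.
elim: r L => [|r IHr] L L0 LD LN L_free.
  by exists 0%N => k m /L_free->//; rewrite normr0 mul0r.
pose L' k m := L k m /\ m r = 0.
have [||||M' M'P] := IHr L'.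
- by split.
- by move=> k m k' m' [? mr] [? m'r]; split; [exact: LD|rewrite mr m'r addr0].
- by move=> k m [? mr]; split; [exact: LN|rewrite mr oppr0].
- move=> k m [Lkm mr] m0; apply: L_free Lkm _ => i.
  by rewrite ltnS leq_eqVlt => /predU1P[->//|/m0].
have [[k0 [m0 [Lkm0 m0r]]]|no] := pselect (exists k m, L k m /\ m r != 0); last first.
  exists M' => k m Lkm; have mr : m r = 0.
    by apply/eqP; apply: contrapT => /negP mr; apply: no; exists k, m.
  by rewrite big_ord_recr /= mr normr0 addr0; exact: M'P.
pose B := \sum_(i < r) `|m0 i|.
have B0 : 0 <= B by apply: sumr_ge0.
exists (`|k0|%N + M' * `|m0 r|%N + M' * `|B|%N)%N => k m Lkm.
have Lcomb : L' (m0 r * k + - (m r) * k0) (fun i => m0 r * m i + - (m r) * m0 i).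
  split; last by rewrite /= mulNr mulrC subrr.
  exact: (LD _ _ _ _ (closed_scale L0 LD LN (m0 r) Lkm)
    (closed_scale L0 LD LN (- m r) Lkm0)).
have := M'P _ _ Lcomb; rewrite mulNr => le1.
pose C := \sum_(i < r) `|m i|.
have le2 : \sum_(i < r) `|m0 r * m i + - m r * m0 i| <= `|m0 r| * C + `|m r| * B.
  rewrite !mulr_sumr -big_split /=; apply: ler_sum => i _.
  by rewrite (le_trans (ler_normD _ _)) // mulNr normrN !normrM.
have le3 : `|m0 r * k| <= `|m r| * `|k0| + M'%:Z * (`|m0 r| * C + `|m r| * B).
  have -> : m0 r * k = (m0 r * k - m r * k0) + m r * k0 by rewrite subrK.
  rewrite (le_trans (ler_normD _ _)) // addrC normrM lerD2l.
  by rewrite (le_trans le1) // ler_wpM2l.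
have le4 : `|k| <= `|m0 r * k|.
  have : 0 < `|m0 r| by rewrite normr_gt0.
  by rewrite normrM => m0r_gt0; apply: ler_peMl => //; rewrite -gtz0_ge1.
rewrite big_ord_recr /= -/C; apply: (le_trans le4); apply: (le_trans le3).
have C0 : 0 <= C by apply: sumr_ge0.
rewrite !PoszD !PoszM !abszE (ger0_norm B0).
have bound (M x y z b c : int) : 0 <= M -> 0 <= x -> 0 <= z -> 0 <= b -> 0 <= c ->
    y * z + M * (x * c + y * b) <= (z + M * x + M * b) * (c + y) - M * x * y.
  move=> M0 x0 z0 b0 c0; have : 0 <= z * c by exact: mulr_ge0.
  have : 0 <= M * b * c by rewrite !mulr_ge0.
  lra.
apply: le_trans (bound _ _ _ _ _ _ _ _ _ _ _) _ => //.
by rewrite gerBl !mulr_ge0.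
Qed.

End LatticeOfRelations.

Section IntegerPowers.
Variable G : groupType.
Implicit Types x y : G.
Local Open Scope group_scope.

Lemma expgzD1 x m : expgz x (m + 1) = expgz x m * x.
Proof.
case: m => m.
  have -> : (Posz m + 1)%R = Posz m.+1 by lia.
  by rewrite /= expgSr.
case: m => [|m]; first by rewrite /= expg1 mulVg.
have -> : (Negz m.+1 + 1)%R = Negz m by rewrite !NegzE; lia.
by rewrite /= [x ^+ m.+2]expgS invgM -mulgA mulVg mulg1.
Qed.

Lemma expgzD x m k : expgz x (m + k) = expgz x m * expgz x k.
Proof.
have expgzD_nat j (c : nat) : expgz x (j + c%:Z) = expgz x j * expgz x c.
  elim: c => [|c IHc]; first by rewrite addr0 mulg1.
  by rewrite -addn1 PoszD addrA !expgzD1 IHc mulgA.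
case: k => c; first exact: expgzD_nat.
apply: (@mulIg _ (expgz x c.+1)); rewrite -expgzD_nat NegzE subrK.
by rewrite -mulgA -NegzE /= mulVg mulg1.
Qed.

Lemma commute_expgz x y m k : commute x y -> commute (expgz x m) (expgz y k).
Proof.
have half u v j : commute u v -> commute u (expgz v j).
  by case: j => j uv /=; [exact: commuteX|apply: commuteV; exact: commuteX].
by move=> xy; exact/half/commute_sym/half/commute_sym.
Qed.

End IntegerPowers.

Section AbelianSubgroups.
Variables (G : groupType) (s : seq G) (z : G).
Hypotheses (s_comm : {in s &, forall x y, commute x y}).
Local Open Scope group_scope.

Let ev (m : nat -> int) := \prod_(i < size s) expgz (nth 1 s i) (m i).

Let evD m k : ev (fun i => m i + k i)%R = ev m * ev k.
Proof.
rewrite /ev -prodgM_commute; first by apply: eq_bigr => i _; exact: expgzD.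
by move=> i j _ _; apply: commute_expgz; apply: s_comm; exact: mem_nth.
Qed.

Let ev0 : ev (fun=> 0%R) = 1. Proof. by rewrite /ev big1. Qed.

Let ev_delta j : (j < size s)%N -> ev (fun i => (i == j)%:Z) = nth 1 s j.
Proof.
move=> js; rewrite /ev -(big_mkord xpredT (fun i => expgz (nth 1 s i) (i == j)%:Z)).
rewrite (big_cat_nat (n := j)) //=; last exact: ltnW.
rewrite [X in (X * _)%g]big_nat_cond [X in (X * _)%g]big1 => [|i /andP[/andP[_ ij] _]]; last first.
  by rewrite (ltn_eqF ij).
rewrite mul1g big_ltn // eqxx big_nat_cond big1 ?mulg1 ?expg1 // => i /andP[/andP[ji _] _].
by rewrite (gtn_eqF ji).
Qed.

Let ev_word (w : seq G) : {subset w <= s} ->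
  exists2 m, ev m = \prod_(x <- w) x & (\sum_(i < size s) `|m i| <= (size w)%:Z)%R.
Proof.
elim: w => [_|x w IHw xws].
  by exists (fun=> 0%R); rewrite ?ev0 ?big_nil // big1 // => i _; rewrite normr0.
have [|m evm lem] := IHw; first by move=> y yw; apply: xws; rewrite inE yw orbT.
have xs : x \in s by apply: xws; rewrite mem_head.
have ix : (index x s < size s)%N by rewrite index_mem.
exists (fun i => (i == index x s)%:Z + m i)%R.
  by rewrite evD ev_delta // nth_index // big_cons evm.
rewrite /= -add1n PoszD; apply: (@le_trans _ _
    (\sum_(i < size s) ((i == index x s :> nat)%:Z + `|m i|))%R).
  by apply: ler_sum => i _; rewrite (le_trans (ler_normD _ _)) // lerD2r normr_nat.
rewrite big_split /= lerD // (bigD1 (Ordinal ix)) //= eqxx big1 ?addr0 // => i.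
by rewrite -val_eqE /= => /negbTE->.
Qed.

(** In a finitely generated abelian group elements of infinite order are
    undistorted: the relations between a power of [z] and the generators form a
    lattice to which [relation_bound] applies. *)
Lemma abelian_undistorted : ~ torsion z ->
  exists M : nat, forall k (w : seq G), {subset w <= s} ->
    z ^+ k = \prod_(x <- w) x -> (k <= M * size w)%N.
Proof.
move=> z_inf; pose L k m := expgz z k = ev m.
have [||||M MP] := @relation_bound (size s) L.
- by rewrite /L ev0.
- by move=> k m k' m'; rewrite /L expgzD evD => -> ->.
- move=> k m; rewrite /L => e; apply: (@mulIg _ (expgz z k)).
  rewrite -expgzD addNr e -evD -[LHS]ev0; apply: eq_bigr => i _.
  by rewrite addNr.
- move=> k m; rewrite /L => e m0; have {e} : expgz z k = 1.
    by rewrite e /ev big1 // => i _; rewrite m0.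
  case: k => [[//|k]|k] /= zk; first by case: z_inf; exists k.+1.
  by case: z_inf; exists k.+1 => //; apply/eqP; rewrite -invg_eq1 zk.
exists M => k w ws zk; have [m evm lem] := ev_word ws.
have := MP k m; rewrite /L evm -zk => /(_ erefl); rewrite ger0_norm // => le1.
rewrite -lez_nat PoszM (le_trans le1) // ler_wpM2l //.
Qed.

End AbelianSubgroups.

Section SemiHyperbolic.
Variables (K : realType) (G : groupType) (S : set G) (d : G -> G -> nat).
Hypotheses (finS : finite_set S) (d_word : is_word_metric S d).
Local Open Scope group_scope.
Implicit Types x y z g h p q : G.

Let len g := d 1 g.

Let dE x y : d x y = len (x^-1 * y).
Proof.
have [[w [wS wxy sw]] min] := d_word x y.
have [[w' [w'S w'xy sw']] min'] := d_word 1 (x^-1 * y).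
apply/eqP; rewrite eqn_leq; apply/andP; split.
  by rewrite /len -sw'; apply: min => //; rewrite w'xy invg1 mul1g.
by rewrite -sw; apply: min' => //; rewrite wxy invg1 mul1g.
Qed.

Let len_word g : exists w : seq G,
  [/\ word_over S w, \prod_(a <- w) a = g & size w = len g].
Proof.
have [[w [wS wg sw]] _] := d_word 1 g.
by exists w; split=> //; rewrite wg invg1 mul1g.
Qed.

Let lenM g h : (len (g * h) <= len g + len h)%N.
Proof.
have [w [wS wg <-]] := len_word g; have [w' [w'S w'h <-]] := len_word h.
have [_ min] := d_word 1 (g * h); rewrite -size_cat; apply: min.
  by move=> a; rewrite mem_cat => /orP[/wS|/w'S].
by rewrite big_cat wg w'h invg1 mul1g.
Qed.

Let len1 : len 1 = 0%N.
Proof.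
have [_ min] := d_word 1 1; apply/eqP; rewrite -leqn0; apply: (min [::]) => //.
by rewrite big_nil mulVg.
Qed.

Let lenX g m : (len (g ^+ m) <= m * len g)%N.
Proof.
elim: m => [|m IHm]; first by rewrite expg0 len1.
by rewrite expgS mulSn (leq_trans (lenM _ _)) // leq_add2l.
Qed.

Let ball_finite (r : nat) : exists b : seq G, forall g, (len g <= r)%N -> g \in b.
Proof.
have [s sS] := (finite_seqP S).1 finS.
have [ws wsP] := bounded_words (s ++ [seq a^-1 | a <- s]) r.
exists [seq \prod_(a <- w) a | w <- ws] => g lg.
have [w [wS wg sw]] := len_word g; rewrite -wg; apply: map_f; apply: wsP; last by rewrite sw.
move=> a /wS; rewrite mem_cat sS /= => -[->//|a's].
by rewrite -[a]invgK map_f ?orbT.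
Qed.

Variables (s : G -> G -> nat -> G) (T : G -> G -> nat) (lam eps k1 k2 : K).
Hypotheses (lam1 : (1 <= lam)%R) (eps0 : (0 <= eps)%R).
Hypotheses (k10 : (0 <= k1)%R) (k20 : (0 <= k2)%R).
Hypothesis s_path : forall x y, [/\ s x y 0%N = x,
  forall t, (T x y <= t)%N -> s x y t = y &
  quasi_isometric_on [set t | (t <= T x y)%N]
    (fun t t' : nat => `|t%:R - t'%:R|%R) (fun a b => (d a b)%:R)%R lam eps (s x y)].
Hypothesis s_fellow : forall x y x' y' t,
  ((d (s x y t) (s x' y' t))%:R <= k1 * (maxn (d x x') (d y y'))%:R + k2)%R.
Hypothesis s_equiv : forall g x y t, g * s x y t = s (g * x) (g * y) t.

Let centralizes (cs : seq G) g := forall c, c \in cs -> commute g c.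

(** For [g] centralizing [cs], the paths from [1] to [g] and from [c] to
    [c g = g c] fellow-travel, so the conjugates of [cs] by the points of the
    first path stay in a finite set.  Two points with the same conjugates differ
    by an element of the centralizer; so the path stays close to it. *)
Lemma centralizer_undistorted (cs : seq G) : exists Q : seq G,
  (forall x, x \in Q -> centralizes cs x) /\
  forall g, centralizes cs g -> exists w : seq G, [/\ {subset w <= Q},
    \prod_(x <- w) x = g & ((size w)%:R <= lam * ((len g)%:R + eps))%R].
Proof.
have [r rP] : exists r : nat, forall c, c \in cs -> (k1 * (len c)%:R + k2 <= r%:R)%R.
  elim: cs => [|c cs [r rP]]; first by exists 0%N.
  have [k kP] : exists k : nat, (k1 * (len c)%:R + k2 <= k%:R)%R.
    exists (Num.bound (k1 * (len c)%:R + k2)%R); apply: ltW; apply: archi_boundP.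
    by rewrite addr_ge0 // mulr_ge0.
  exists (r + k)%N => c'; rewrite inE natrD => /predU1P[->|/rP le_r].
    by rewrite (le_trans kP) // lerDr.
  by rewrite (le_trans le_r) // lerDl.
have [B BP] := ball_finite r.
have [U UP] := bounded_words B (size cs).
have [step stepP] : exists k : nat, (lam + eps <= k%:R)%R.
  exists (Num.bound (lam + eps)%R); apply: ltW; apply: archi_boundP.
  by rewrite addr_ge0 // (le_trans ler01).
have [B' B'P] := ball_finite step.
pose type p := [seq c ^ p | c <- cs].
pose rep u := if u == cs then 1 else xget 1 [set q | type q = u].
have type1 : type 1 = cs.
  by rewrite /type -[RHS]map_id; apply/eq_map => c; rewrite conjg1.
have repP p : type (rep (type p)) = type p.
  rewrite {1}/rep; case: eqP => [-> //|_].
  by case: xgetP => [q _ //|/(_ p)]; case.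
pose near p := p * (rep (type p))^-1.
have near_cent p : centralizes cs (near p).
  move=> c cc; apply: commute_sym; apply/commgP/conjg_fixP.
  have /eq_in_map/(_ _ cc) e := repP p.
  by rewrite /near conjgM -e -conjgM mulgV conjg1.
(* [near p] is the point of the centralizer close to [p]: it differs from [p] by
   a representative of the points conjugating [cs] in the same way.  The path
   starts and ends at points of type [cs], whose representative is [1]. *)
pose reps := [seq rep u | u <- U].
pose Q := [seq x <- [seq q * vq.1 * vq.2^-1 | q <- reps,
   vq <- [seq (v, q) | v <- B', q <- reps]] | `[< centralizes cs x >]].
have QP q v q' : q \in reps -> v \in B' -> q' \in reps ->
    centralizes cs (q * v * q'^-1) -> q * v * q'^-1 \in Q.
  move=> qU vB q'U cq; rewrite mem_filter; apply/andP; split; first exact/asboolP.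
  apply: (allpairs_f (fun q vq => q * vq.1 * vq.2^-1) qU (_ : (v, q') \in _)).
  exact: allpairs_f.
exists Q; split=> [x|g gc].
  by rewrite mem_filter => /andP[/asboolP].
pose p t := s 1 g t.
have [p0 pT p_qi] := s_path 1 g.
have type_cent h : centralizes cs h -> type h = cs.
  move=> hc; rewrite -[RHS]map_id; apply/eq_in_map => c cc.
  by apply/conjg_fixP/commgP; apply: commute_sym; exact: hc.
have near0 : near (p 0%N) = 1 by rewrite /p p0 /near type1 /rep eqxx mul1g invg1.
have nearT : near (p (T 1 g)) = g.
  by rewrite /p pT // /near type_cent // /rep eqxx invg1 mulg1.
have typeU t : type (p t) \in U.
  apply: UP; last by rewrite size_map.
  move=> x /mapP[c cc ->]; apply: BP.
  have -> : len (c ^ p t) = d (p t) (s (c * 1) (c * g) t).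
    by rewrite -s_equiv dE conjgE.
  rewrite -(ler_nat K) (le_trans (s_fellow _ _ _ _ _)) //.
  have -> : d g (c * g) = len c.
    by rewrite dE -(gc c cc) mulKg.
  by rewrite mulg1 maxnn; exact: rP.
pose w := [seq (near (p t))^-1 * near (p t.+1) | t <- index_iota 0 (T 1 g)].
exists w; split.
- move=> x /mapP[t]; rewrite mem_index_iota /= => lt_t ->.
  have cQ : centralizes cs ((near (p t))^-1 * near (p t.+1)).
    move=> c cc; apply: commute_sym; apply: commuteM.
      by apply: commuteV; apply: commute_sym; exact: near_cent.
    by apply: commute_sym; exact: near_cent.
  move: cQ; have -> : (near (p t))^-1 * near (p t.+1) =
      rep (type (p t)) * ((p t)^-1 * p t.+1) * (rep (type (p t.+1)))^-1.
    by rewrite /near; group_simp.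
  apply: QP; [exact: map_f| |exact: map_f].
  apply: B'P; rewrite -dE -(ler_nat K) (le_trans _ stepP) //.
  have /andP[_] := p_qi t t.+1 (ltnW lt_t) lt_t.
  by rewrite -natr1 opprD addrA subrr sub0r normrN normr1 mulr1.
- have telescope m : \prod_(0 <= t < m) ((near (p t))^-1 * near (p t.+1)) =
      (near (p 0%N))^-1 * near (p m).
    elim: m => [|m IHm]; first by rewrite big_geq // mulVg.
    by rewrite big_nat_recr //= IHm; group_simp.
  by rewrite /w big_map telescope near0 nearT invg1 mul1g.
rewrite size_map size_iota subn0.
have /andP[+ _] := p_qi 0%N (T 1 g) (leq0n _) (leqnn _).
rewrite p0 pT // sub0r normrN normr_nat => le1.
have lam0 : (0 < lam)%R by exact: lt_le_trans lam1.
rewrite -ler_pdivrMl //; lra.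
Qed.

Let commute_word h (Q w : seq G) : {subset w <= Q} -> centralizes Q h ->
  commute h (\prod_(x <- w) x).
Proof.
by move=> wQ hQ; rewrite big_seq; apply: commute_prod => x /wQ; exact: hQ.
Qed.

(** The center of the centralizer of [z] is the centralizer of a finite set of
    generators [Q1] of the centralizer of [z]; so it is itself undistorted and
    generated by a finite set [Q2].  As it is abelian and contains [z], infinite
    order of [z] would contradict the length [O(m)] of [z ^+ (m * m)]. *)
Lemma fellow_travel_torsion x y : commute [~ x, y] x -> commute [~ x, y] y ->
  torsion [~ x, y].
Proof.
move=> zx zy; apply: contrapT => z_inf; set z := [~ x, y] in zx zy z_inf.
have [Q1 [Q1z Q1P]] := centralizer_undistorted [:: z].
have [Q2 [Q2c Q2P]] := centralizer_undistorted Q1.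
have zz : centralizes [:: z] z by move=> c; rewrite inE => /eqP->.
have zQ1 : centralizes Q1 z.
  by move=> c /Q1z cz; apply: commute_sym; apply: cz; rewrite mem_head.
have Q2z q : q \in Q2 -> commute q z.
  by move=> /Q2c qQ1; have [w [wQ1 <- _]] := Q1P _ zz; exact: commute_word wQ1 qQ1.
have Q2comm : {in Q2 &, forall q q', commute q q'}.
  move=> q q' qQ2 q'Q2; have [|w [wQ1 <- _]] := Q1P q' _.
    by move=> c; rewrite inE => /eqP->; exact: Q2z.
  exact: commute_word wQ1 (Q2c _ qQ2).
have [M MP] := abelian_undistorted Q2comm z_inf.
pose C := (len x^-1 + len y^-1 + len x + len y)%N.
have len_z m : (len (z ^+ (m * m)) <= m * C)%N.
  rewrite -commXX // commgEl conjgE -!expVgn.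
  rewrite /C !mulnDr -!addnA.
  by do 3 ![apply: leq_trans (lenM _ _) _; apply: leq_add; first exact: lenX].
suff : (1 <= 0 :> K)%R by rewrite ler10.
apply: (@bounded_multiples _ _ (M%:R * lam * (C%:R + eps))%R) => m.
have lam0 : (0 <= lam)%R by exact: le_trans lam1.
case: m => [|m]; first by rewrite mul0r !mulr_ge0 ?addr_ge0.
have [|w [wQ2 zw sw]] := Q2P (z ^+ (m.+1 * m.+1)).
  by move=> c cQ1; apply: commute_sym; apply: commuteX; apply: commute_sym; exact: zQ1.
have := MP _ _ wQ2 (esym zw); rewrite -(ler_nat K) !natrM => le1.
have := len_z m.+1; rewrite -(ler_nat K) natrM => le2.
have m1 : (1 <= m.+1%:R :> K)%R by rewrite ler1n.
rewrite mulr1 -(ler_pM2l (_ : 0 < m.+1%:R :> K)%R) ?ltr0n //.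
apply: (le_trans le1); rewrite -mulrA mulrCA; apply: ler_wpM2l => //.
apply: (le_trans sw); rewrite mulrCA; apply: ler_wpM2l => //.
rewrite mulrDr; apply: lerD => //.
by rewrite ler_peMl.
Qed.

End SemiHyperbolic.

Theorem corollary0p9 (K : realType) (R : nzRingType)
    (R_char0 : char_zero R)
    (R_ideals : forall I : set R, two_sided_ideal I -> I <> [set 0] ->
       ideal_finite_index I)
    (n : nat) (n_ge3 : (3 <= n)%N)
    (E : set (GLn R n)) (E_subgroup : is_subgroup E)
    (E_sub : E `<=` elementary_group R n)
    (E_index : finite_index (elementary_group R n) E)
    (G : groupType)
    (G_class : [\/ cat0_group K G, semi_hyperbolic_group K G,
                   acts_properly_semisimply_on_cat0 K G
                 | acts_properly_semisimply_on_hyperbolic K G])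
    (f : GLn R n -> G)
    (f_morph : {in E &, {morph f : x y / (x * y)%g}}) :
  finite_set (f @` E).
Proof.
apply: heisenberg_torsion_finite_image => // x y zx zy.
case: G_class => [[X [act [Xcat0 act_isom prop cocpt]]]
  |[S [d [s [T [lam [eps [k1 [k2 [[finS dS] [lam1 eps0 k10 k20] paths fellow equiv]]]]]]]]]
  |[X [act [Xcat0 act_isom prop ss]]]
  |[X [delta [act [_ [[X0 _] _] act_isom prop ss]]]]].
- exact: (cat0_cocompact_torsion act_isom Xcat0 prop cocpt zx zy).
- exact: (fellow_travel_torsion finS dS lam1 eps0 k10 k20 paths fellow equiv zx zy).
- exact: (cat0_semisimple_torsion act_isom Xcat0 prop (ss _) zx zy).
- exact: (hyperbolic_torsion act_isom X0 prop (ss _) zx zy).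
Qed.
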